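(* Let $a,b,c\in\mathbb{R}$ with $c\neq 0$ and $(a,b)\neq(0,0)$, and let $p\geq 1$ be an integer. Consider the system for $u=u(t,x)$, $v=v(t,x)$ $$F_1\equiv u_t + a[(u^p + v^p)u]_x + b[(uv)^pv]_x + cu_{xxx} = 0,\qquad F_2\equiv v_t + a[(u^p + v^p)v]_x + b[(uv)^pu]_x + cv_{xxx} = 0.$$ Define the vector fields $$X_1 = 3t\frac{\partial}{\partial t} + x\frac{\partial}{\partial x} - \frac{1}{p}\left(u\frac{\partial}{\partial u} + v\frac{\partial}{\partial v}\right),\quad Y_1 = 3t\frac{\partial}{\partial t} + x\frac{\partial}{\partial x} - \frac{2}{p}\left(u\frac{\partial}{\partial u} + v\frac{\partial}{\partial v}\right),$$ $$X_2 = \frac{\partial}{\partial t},\quad X_3 = \frac{\partial}{\partial x},\quad X_4 = v\left(\frac{\partial}{\partial u} - \frac{\partial}{\partial v}\right),\quad Y_4 = v\frac{\partial}{\partial u} - u\frac{\partial}{\partial v},\quad X_5 = u\left(\frac{\partial}{\partial u} - \frac{\partial}{\partial v}\right).$$ Then the vector space of generators of Lie point symmetries of the system is spanned by the following vector fields: (1) if $a=0$: $X_1, X_2, X_3$; (2) if $b=0$: $Y_1, X_2, X_3$, together with $X_4$ and $X_5$ when $p=1$, and together with $Y_4$ when $p=2$; (3) if $ab\neq 0$: $X_2, X_3$.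
   Context: All functions are smooth. A generator of Lie point symmetries of the system is a vector field $$X = \mathcal{T}(t,x,u,v)\frac{\partial}{\partial t} + \mathcal{X}(t,x,u,v)\frac{\partial}{\partial x} + \mathcal{U}(t,x,u,v)\frac{\partial}{\partial u} + \mathcal{V}(t,x,u,v)\frac{\partial}{\partial v}$$ whose (third-order) prolongation $\mathrm{pr}X$ to the space of derivatives satisfies the invariance conditions $\mathrm{pr}X(F_1)=MF_1+NF_2$ and $\mathrm{pr}X(F_2)=PF_1+QF_2$ for some coefficient functions $M,N,P,Q$ (on the space of $t,x,u,v$ and derivatives of $u,v$). Here the component of $\mathrm{pr}X$ along a derivative $\partial_J u$ is $D_J W^u+\mathcal{T}D_t\partial_J u+\mathcal{X}D_x\partial_J u$ with $W^u=\mathcal{U}-\mathcal{T}u_t-\mathcal{X}u_x$, and similarly for $v$ with $W^v=\mathcal{V}-\mathcal{T}v_t-\mathcal{X}v_x$; $D_t,D_x$ are total derivatives. *)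

(* Defs.v *)
From HB Require Import structures.
From mathcomp Require Import all_boot all_order all_algebra.
From mathcomp Require Import all_classical all_reals all_analysis.

Set Implicit Arguments.
Unset Strict Implicit.
Unset Printing Implicit Defensive.

Import Order.TTheory GRing.Theory Num.Theory.
Import numFieldNormedType.Exports.

Local Open Scope classical_set_scope.
Local Open Scope ring_scope.

Section CoordinateCalculus.
Variables (R : realType) (I : eqType).
Implicit Types (f : (I -> R) -> R) (q : I -> R) (z : I).

(* [dfwith q z s] is the point q with its z-coordinate replaced by s. *)
Definition pderivable z f q : Prop :=
  derivable (fun s : R => f (@dfwith I (fun=> R) q z s)) (q z) 1.

Definition pderiv z f q : R :=
  derive1 (fun s : R => f (@dfwith I (fun=> R) q z s)) (q z).

(* Continuity is for the product topology on I -> R, which is the usual one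
   on R^n when I is finite. *)
Fixpoint Cn (n : nat) f : Prop :=
  continuous (f : {ptws I -> R} -> R) /\
  match n with
  | 0 => True
  | m.+1 => forall z, (forall q, pderivable z f q) /\ Cn m (pderiv z f)
  end.

Definition smooth f : Prop := forall n, Cn n f.

End CoordinateCalculus.

(* Coordinates t, x, u, v of the space on which point symmetries act. *)
Variant bvar := Bt | Bx | Bu | Bv.

Definition bvar_code (z : bvar) : bool * bool :=
  match z with
  | Bt => (false, false)
  | Bx => (false, true)
  | Bu => (true, false)
  | Bv => (true, true)
  end.

Definition bvar_decode (k : bool * bool) : bvar :=
  match k with
  | (false, false) => Bt
  | (false, true) => Bx
  | (true, false) => Bu
  | (true, true) => Bv
  end.

Lemma bvar_codeK : cancel bvar_code bvar_decode.
Proof. by case. Qed.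

HB.instance Definition _ := Equality.copy bvar (can_type bvar_codeK).

(* Coordinates of the infinite jet space: t, x, and the derivatives
   [Ju i j] = d_t^i d_x^j u, [Jv i j] = d_t^i d_x^j v. *)
Variant jvar := Jt | Jx | Ju of nat & nat | Jv of nat & nat.

Definition jvar_code (z : jvar) : bool + bool * (nat * nat) :=
  match z with
  | Jt => inl false
  | Jx => inl true
  | Ju i j => inr (false, (i, j))
  | Jv i j => inr (true, (i, j))
  end.

Definition jvar_decode (k : bool + bool * (nat * nat)) : jvar :=
  match k with
  | inl false => Jt
  | inl true => Jx
  | inr (false, (i, j)) => Ju i j
  | inr (true, (i, j)) => Jv i j
  end.

Lemma jvar_codeK : cancel jvar_code jvar_decode.
Proof. by case. Qed.

HB.instance Definition _ := Equality.copy jvar (can_type jvar_codeK).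

Definition jorder (z : jvar) : nat :=
  match z with
  | Jt | Jx => 0
  | Ju i j | Jv i j => i + j
  end.

Definition jet (R : realType) := jvar -> R.

(* [X z] is the component of the vector field X along the coordinate z. *)
Definition vfield (R : realType) := bvar -> (bvar -> R) -> R^o.

Section Symmetries.
Variable R : realType.
Implicit Types (f F : jet R -> R) (J : jet R) (X : vfield R).

(* Smooth functions of t, x, u, v and finitely many derivatives of u, v. *)
Definition diff_fun f : Prop :=
  smooth f /\
  exists n : nat, forall J J' : jet R,
    (forall z, (jorder z <= n)%N -> J z = J' z) -> f J = f J'.

(* [\sum_(k \in [set: nat * nat])] is a finitely supported sum: a function of
   finite order has only finitely many nonzero partial derivatives. *)
Definition Dt f J : R :=
  pderiv Jt f J +
  \sum_(k \in [set: nat * nat])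
    (J (Ju k.1.+1 k.2) * pderiv (Ju k.1 k.2) f J +
     J (Jv k.1.+1 k.2) * pderiv (Jv k.1 k.2) f J).

Definition Dx f J : R :=
  pderiv Jx f J +
  \sum_(k \in [set: nat * nat])
    (J (Ju k.1 k.2.+1) * pderiv (Ju k.1 k.2) f J +
     J (Jv k.1 k.2.+1) * pderiv (Jv k.1 k.2) f J).

Definition jbase J (z : bvar) : R :=
  match z with
  | Bt => J Jt
  | Bx => J Jx
  | Bu => J (Ju 0 0)
  | Bv => J (Jv 0 0)
  end.

Definition Wu X J : R :=
  X Bu (jbase J) - X Bt (jbase J) * J (Ju 1 0) - X Bx (jbase J) * J (Ju 0 1).

Definition Wv X J : R :=
  X Bv (jbase J) - X Bt (jbase J) * J (Jv 1 0) - X Bx (jbase J) * J (Jv 0 1).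

(* Component of the prolongation along d_t^i d_x^j u; D_J W = D_t^i D_x^j W. *)
Definition pr_u X (i j : nat) J : R :=
  iter i Dt (iter j Dx (Wu X)) J
  + X Bt (jbase J) * J (Ju i.+1 j) + X Bx (jbase J) * J (Ju i j.+1).

Definition pr_v X (i j : nat) J : R :=
  iter i Dt (iter j Dx (Wv X)) J
  + X Bt (jbase J) * J (Jv i.+1 j) + X Bx (jbase J) * J (Jv i j.+1).

(* Third-order prolongation of X, applied as a derivation to F; it sees only
   the derivatives of u, v up to order 3. *)
Definition pr3 X F J : R :=
  X Bt (jbase J) * pderiv Jt F J + X Bx (jbase J) * pderiv Jx F J
  + \sum_(i < 4) \sum_(j < 4 | (i + j <= 3)%N)
      (pr_u X i j J * pderiv (Ju i j) F J + pr_v X i j J * pderiv (Jv i j) F J).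

Definition lie_generator F1 F2 X : Prop :=
  (forall z, smooth (X z)) /\
  exists M N P Q : jet R -> R,
    [/\ diff_fun M, diff_fun N, diff_fun P & diff_fun Q] /\
    forall J, pr3 X F1 J = M J * F1 J + N J * F2 J /\
              pr3 X F2 J = P J * F1 J + Q J * F2 J.

Definition vspan (s : seq (vfield R)) : set (vfield R) :=
  [set X | exists k : 'I_(size s) -> R, X = \sum_(i < size s) k i *: s`_i].

Definition F1 (a b c : R) (p : nat) J : R :=
  J (Ju 1 0)
  + a * Dx (fun J => (J (Ju 0 0) ^+ p + J (Jv 0 0) ^+ p) * J (Ju 0 0)) J
  + b * Dx (fun J => (J (Ju 0 0) * J (Jv 0 0)) ^+ p * J (Jv 0 0)) J
  + c * J (Ju 0 3).

Definition F2 (a b c : R) (p : nat) J : R :=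
  J (Jv 1 0)
  + a * Dx (fun J => (J (Ju 0 0) ^+ p + J (Jv 0 0) ^+ p) * J (Jv 0 0)) J
  + b * Dx (fun J => (J (Ju 0 0) * J (Jv 0 0)) ^+ p * J (Ju 0 0)) J
  + c * J (Jv 0 3).

Definition vf (T X U V : (bvar -> R) -> R) : vfield R := fun z =>
  match z with Bt => T | Bx => X | Bu => U | Bv => V end.

Definition X1 (p : nat) : vfield R :=
  vf (fun q => 3 * q Bt) (fun q => q Bx)
     (fun q => - (1 / p%:R) * q Bu) (fun q => - (1 / p%:R) * q Bv).

Definition Y1 (p : nat) : vfield R :=
  vf (fun q => 3 * q Bt) (fun q => q Bx)
     (fun q => - (2 / p%:R) * q Bu) (fun q => - (2 / p%:R) * q Bv).

Definition X2 : vfield R := vf (fun=> 1) (fun=> 0) (fun=> 0) (fun=> 0).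

Definition X3 : vfield R := vf (fun=> 0) (fun=> 1) (fun=> 0) (fun=> 0).

Definition X4 : vfield R :=
  vf (fun=> 0) (fun=> 0) (fun q => q Bv) (fun q => - q Bv).

Definition Y4 : vfield R :=
  vf (fun=> 0) (fun=> 0) (fun q => q Bv) (fun q => - q Bu).

Definition X5 : vfield R :=
  vf (fun=> 0) (fun=> 0) (fun q => q Bu) (fun q => - q Bu).

End Symmetries.

Arguments X1 R p : clear implicits.
Arguments Y1 R p : clear implicits.
Arguments X2 R : clear implicits.
Arguments X3 R : clear implicits.
Arguments X4 R : clear implicits.
Arguments Y4 R : clear implicits.
Arguments X5 R : clear implicits.

(* Main.v *)
Require Import Defs.
From mathcomp Require Import all_boot all_order all_algebra.
From mathcomp Require Import all_classical all_reals all_analysis.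
From mathcomp Require Import finmap zify ring lra.

Set Implicit Arguments.
Unset Strict Implicit.
Unset Printing Implicit Defensive.

Import Order.TTheory GRing.Theory Num.Theory.
Import numFieldNormedType.Exports.

Local Open Scope classical_set_scope.
Local Open Scope ring_scope.

(** The prolongation of a symmetry generator T d_t + X d_x + U d_u + V d_v
annihilates both equations at the jets that solve them. This is a polynomial
identity in the derivatives of u and v, which are free apart from u_t and v_t,
and its coefficients determine the generator.

- Each equation has the form w_t + h1 u_x + h2 v_x + c w_xxx = 0 with h1, h2
  functions of u and v ([kdv_lhs]). The prolongation of order three of the
  field is computed from the Leibniz rule for total derivatives ([prol03]).
- The jet coordinate u_txx occurs with coefficient -3 c D_x T, so that T
  depends on t only. Then u_xx^2 and u_xx v_xx force X = X(t, x), the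
  coefficient of u_xxx gives T_t = 3 X_x, and the terms in u_xx and v_xx make
  U and V affine in (u, v), with linear parts that do not depend on x
  ([sym_T_of_t], [sym_X_of_tx], [sym_Tt_Xx], [sym_UV_affine]).
- A first order identity remains ([sym_first_order]). At each point (t, x) its
  coefficients along u_x and v_x are polynomial identities in (u, v) relating
  the numbers X_x, X_t and the coefficients of U and V ([flux_eqs]). The fluxes
  are sums of a form of degree p + 1 (factor a) and a form of degree 2 p + 1
  (factor b), so these identities split into homogeneous parts
  ([flux_eqs_homogeneous]), from which X_t and the constant parts of U and V
  vanish and the linear parts satisfy the relations [sols_b] or [sols_a].
- What is left of the first order identity says that U and V do not depend on
  t. Hence all components have constant gradients and are affine
  ([generator_affine]); conversely each affine field subject to the relations
  changes the equations by constant linear combinations of themselves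
  ([affine_field_generator]). The relations are then solved in each case. *)

(** * Partial derivatives and smooth functions *)

Lemma mul0_cancel (K : idomainType) (x y : K) : x != 0 -> x * y = 0 -> y = 0.
Proof. by move=> x0 /eqP; rewrite mulf_eq0 (negbTE x0) => /eqP. Qed.
Arguments mul0_cancel {K} x y _ _.

Section PartialDerivatives.
Variables (R : realType) (I : eqType).
Implicit Types (f g : (I -> R) -> R) (q : I -> R) (z w : I) (s r : R).

Local Notation upd := (@dfwith I (fun=> R)).

(** A relational form of [pderiv]: it carries derivability along, so that
derivatives of compound expressions are found by composing rules. *)
Definition is_pderiv z f f' :=
  forall q, is_derive (q z) (1 : R) (fun s : R => f (upd q z s) : R) (f' q).

Lemma upd_id q z : upd q z (q z) = q.
Proof. by apply/funext => w; case: dfwithP. Qed.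

Lemma upd_upd q z s r : upd (upd q z s) z r = upd q z r.
Proof.
by apply/funext => w; case: (eqVneq z w) => [<-|zw]; rewrite ?dfwithin ?dfwithout.
Qed.

Lemma updC q z w s r : z != w ->
  upd (upd q z s) w r = upd (upd q w r) z s.
Proof.
move=> zw; apply/funext => y.
case: (eqVneq z y) => [<-|zy]; first by rewrite dfwithin dfwithout ?dfwithin // eq_sym.
case: (eqVneq w y) => [<-|wy]; first by rewrite dfwithin dfwithout // dfwithin.
by rewrite !dfwithout.
Qed.

Lemma is_pderivP z f f' :
  is_pderiv z f f' <-> (forall q, pderivable z f q) /\ pderiv z f = f'.
Proof.
split=> [ff'|[df <-] q].
  split=> [q|]; first by have [] := ff' q.
  by apply/funext => q; rewrite /pderiv derive1E; have [] := ff' q.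
by rewrite /pderiv derive1E; apply: derivableP; apply: df.
Qed.

Lemma pderivE z f f' : is_pderiv z f f' -> pderiv z f = f'.
Proof. by move=> /is_pderivP[]. Qed.

Lemma is_pderiv_ext z f f' g' : f' =1 g' -> is_pderiv z f f' -> is_pderiv z f g'.
Proof. by move=> /funext->. Qed.

Lemma is_pderiv_cst z (k : R) : is_pderiv z (fun=> k) (fun=> 0).
Proof. by move=> q; apply: is_derive_cst. Qed.

Lemma is_pderiv_coord z w :
  is_pderiv z (fun q => q w) (fun=> (z == w)%:R).
Proof.
move=> q; case: eqVneq => [<-|zw].
  rewrite (_ : (fun s => _) = id); last by apply/funext => s; rewrite dfwithin.
  exact: is_derive_id.
rewrite (_ : (fun s => _) = cst (q w)); first exact: is_derive_cst.
by apply/funext => s; rewrite dfwithout.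
Qed.

Lemma is_pderivD z f g f' g' : is_pderiv z f f' -> is_pderiv z g g' ->
  is_pderiv z (fun q => f q + g q) (fun q => f' q + g' q).
Proof. by move=> ff' gg' q; apply: is_deriveD. Qed.

Lemma is_pderivM z f g f' g' : is_pderiv z f f' -> is_pderiv z g g' ->
  is_pderiv z (fun q => f q * g q) (fun q => f' q * g q + f q * g' q).
Proof.
move=> ff' gg' q; apply: is_derive_eq; first exact: is_deriveM.
by rewrite /= !(upd_id q z) /GRing.scale /= addrC [g q * _]mulrC.
Qed.

Lemma is_pderivX z f f' n : is_pderiv z f f' ->
  is_pderiv z (fun q => f q ^+ n) (fun q => n%:R * f q ^+ n.-1 * f' q).
Proof.
move=> ff'; elim: n => [|n IH].
  by apply: is_pderiv_ext (is_pderiv_cst z 1) => q; rewrite !mul0r.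
under eq_fun do rewrite exprS.
apply: is_pderiv_ext (is_pderivM ff' IH) => q /=.
by case: n {IH} => [|n] /=; rewrite ?exprS ?expr0 -?[n.+2%:R]natr1; ring.
Qed.

Lemma pderiv_line z f q (k : R) : (forall q', pderivable z f q') ->
  (forall s, pderiv z f (upd q z s) = k) ->
  forall s r, f (upd q z r) = f (upd q z s) + k * (r - s).
Proof.
move=> df fk s r.
have dg t : is_derive t (1 : R) (fun t => f (upd q z t) - k * t : R) 0.
  have H : is_derive t (1 : R) (fun t => f (upd q z t) : R) k.
    have /is_pderivP/(_ (upd q z t)) :
      (forall q', pderivable z f q') /\ pderiv z f = pderiv z f by [].
    rewrite fk dfwithin; under eq_fun do rewrite upd_upd.
    by [].
  apply: is_derive_eq.
  by rewrite /GRing.scale/= mulr1 subrr.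
have := is_derive_0_is_cst r s dg.
by move=> /= E; rewrite mulrBr; lra.
Qed.

Lemma pderiv0_upd z f : (forall q, pderivable z f q) ->
  pderiv z f = (fun=> 0) -> forall q s, f (upd q z s) = f q.
Proof.
move=> df f0 q s; rewrite (@pderiv_line z f q 0 df _ (q z)) ?mul0r ?addr0 ?upd_id //.
by move=> r; rewrite f0.
Qed.

Lemma upd_pderiv0 z f : (forall q s, f (upd q z s) = f q) -> pderiv z f = (fun=> 0).
Proof.
move=> fz; apply/funext => q; rewrite /pderiv.
by under eq_fun do rewrite fz; rewrite derive1_cst.
Qed.

(** If f ignores z, so do its difference quotients in any other direction. *)
Lemma pderiv0_pderiv z w f : (forall q, pderivable z f q) ->
  pderiv z f = (fun=> 0) -> pderiv z (pderiv w f) = (fun=> 0).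
Proof.
move=> df f0; apply: upd_pderiv0 => q s.
have fz := pderiv0_upd df f0.
case: (eqVneq z w) => [<-|zw]; first by rewrite f0.
rewrite /pderiv dfwithout //; congr (derive1 _ _).
by apply/funext => r; rewrite updC // fz.
Qed.

Lemma pderiv_cst0 z (k : R) : pderiv z (fun=> k) = (fun=> 0 : R).
Proof. exact: pderivE (is_pderiv_cst z k). Qed.

Lemma smooth_pderivable f z q : smooth f -> pderivable z f q.
Proof. by move=> /(_ 1%N)/= [_ /(_ z)[]]. Qed.

Lemma smooth_pderiv f z : smooth f -> smooth (pderiv z f).
Proof. by move=> sf n; have [_ /(_ z)[]] := sf n.+1. Qed.

Lemma smooth_is_pderiv f z : smooth f -> is_pderiv z f (pderiv z f).
Proof. by move=> sf; apply/is_pderivP; split=> // q; apply: smooth_pderivable. Qed.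

Lemma CnW n f : Cn n.+1 f -> Cn n f.
Proof.
elim: n f => [|n IH] f; first by case.
move=> [cf df]; split=> // z; have [dz /IH] := df z.
by split.
Qed.

Lemma CnS n f : continuous (f : {ptws I -> R} -> R) ->
  (forall z, exists2 f', is_pderiv z f f' & Cn n f') -> Cn n.+1 f.
Proof.
move=> cf df; split=> // z; have [f' /is_pderivP[dz <-] Cf'] := df z.
by split.
Qed.

Lemma is_pderiv_restr z w f (k : R) : z != w -> smooth f ->
  is_pderiv w (fun q => f (upd q z k)) (fun q => pderiv w f (upd q z k)).
Proof.
move=> zw sf q.
have := smooth_is_pderiv w sf (upd q z k).
rewrite dfwithout //; congr is_derive.
by apply/funext => r; rewrite updC.
Qed.

Lemma is_pderiv_restr0 z f (k : R) : is_pderiv z (fun q => f (upd q z k)) (fun=> 0).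
Proof.
move=> q; under eq_fun do rewrite upd_upd.
exact: is_derive_cst.
Qed.

(** If the second z-derivative vanishes then f = g + z h with g and h
independent of z, and on this explicit form the two derivatives commute. *)
Lemma pderivC_affine z w f : z != w -> smooth f ->
  pderiv z (pderiv z f) = (fun=> 0) ->
  pderiv z (pderiv w f) = pderiv w (pderiv z f).
Proof.
move=> zw sf fzz.
have sfz := smooth_pderiv z sf.
have E : f = fun q => f (upd q z 0) + q z * pderiv z f q.
  apply/funext => q.
  have := @pderiv_line z f q (pderiv z f q)
    (fun q => smooth_pderivable sf) _ 0 (q z).
  rewrite (upd_id q z) subr0 mulrC; apply.
  exact: (pderiv0_upd (fun q => smooth_pderivable sfz) fzz).
have Ew : pderiv w f = fun q => pderiv w f (upd q z 0) + q z * pderiv w (pderiv z f) q.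
  rewrite [in LHS]E.
  rewrite (pderivE (is_pderivD (is_pderiv_restr 0 zw sf)
    (is_pderivM (@is_pderiv_coord w z) (smooth_is_pderiv w sfz)))).
  by apply/funext => q; rewrite eq_sym (negbTE zw) mul0r add0r.
rewrite Ew.
rewrite (pderivE (is_pderivD (is_pderiv_restr0 z _ 0)
    (is_pderivM (@is_pderiv_coord z z) (smooth_is_pderiv z (smooth_pderiv w sfz))))).
rewrite (pderiv0_pderiv _ (fun q => smooth_pderivable sfz) fzz).
by apply/funext => q; rewrite eqxx mul1r mulr0 addr0 add0r.
Qed.

Lemma smooth_cst (k : R) : smooth (fun _ : I -> R => k).
Proof.
have ck (k' : R) : continuous ((fun=> k') : {ptws I -> R} -> R).
  exact: cst_continuous.
move=> n.
elim: n k => [|n IH] k.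
  split; first exact: ck.
  by [].
apply: CnS; first exact: ck.
by move=> z; exists (fun=> 0) => //; apply: is_pderiv_cst.
Qed.

Lemma smooth_coord z : smooth (fun q : I -> R => q z).
Proof.
have cz : continuous ((fun q : I -> R => q z) : {ptws I -> R} -> R).
  by move=> x; apply: (@proj_continuous I (fun=> R) z x).
case=> [|n]; first by split.
apply: CnS => // w; exists (fun=> (w == z)%:R); first exact: is_pderiv_coord.
exact: smooth_cst.
Qed.

Lemma CnD n f g : Cn n f -> Cn n g -> Cn n (fun q => f q + g q).
Proof.
elim: n f g => [|n IH] f g [cf df] [cg dg].
  by split; [exact: (fun x => cvgD (cf x) (cg x))|].
apply: CnS => [|z]; first exact: (fun x => cvgD (cf x) (cg x)).
have [dfz Cf] := df z; have [dgz Cg] := dg z.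
exists (fun q => pderiv z f q + pderiv z g q); last exact: IH.
by apply: is_pderivD; apply/is_pderivP; split.
Qed.

Lemma CnM n f g : Cn n f -> Cn n g -> Cn n (fun q => f q * g q).
Proof.
elim: n f g => [|n IH] f g Hf Hg; have [cf df] := Hf; have [cg dg] := Hg.
  by split; [exact: (fun x => cvgM (cf x) (cg x))|].
apply: CnS => [|z]; first exact: (fun x => cvgM (cf x) (cg x)).
have [dfz Cf] := df z; have [dgz Cg] := dg z.
exists (fun q => pderiv z f q * g q + f q * pderiv z g q).
  by apply: is_pderivM; apply/is_pderivP; split.
apply: CnD; apply: IH.
- exact: Cf.
- exact: CnW Hg.
- exact: CnW Hf.
- exact: Cg.
Qed.

Lemma smoothD f g : smooth f -> smooth g -> smooth (fun q => f q + g q).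
Proof. by move=> sf sg n; apply: CnD. Qed.

Lemma smoothM f g : smooth f -> smooth g -> smooth (fun q => f q * g q).
Proof. by move=> sf sg n; apply: CnM. Qed.

Lemma smoothX f n : smooth f -> smooth (fun q => f q ^+ n).
Proof.
move=> sf; elim: n => [|n IH]; first exact: smooth_cst.
by under eq_fun do rewrite exprS; apply: smoothM.
Qed.

End PartialDerivatives.

Ltac smooth_poly := repeat first [exact: smooth_cst | exact: smooth_coord
  | apply: smoothX | apply: smoothM | apply: smoothD].

(** * Total derivatives on the jet space *)

Section JetCalculus.
Variable R : realType.
Implicit Types (f g : jet R -> R) (h : (bvar -> R) -> R) (J : jet R).

Local Notation upd := (@dfwith _ (fun=> R)).

(** The class on which the sums defining the total derivatives are meaningful:
outside a finite set of indices all partial derivatives vanish. *)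
Definition jet_fun f :=
  (forall z J, pderivable z f J) /\
  exists A : {fset nat * nat}, forall k, k \notin A -> forall J,
    pderiv (Ju k.1 k.2) f J = 0 /\ pderiv (Jv k.1 k.2) f J = 0.

Lemma jet_fun_is_pderiv f z : jet_fun f -> is_pderiv z f (pderiv z f).
Proof. by move=> [df _]; apply/is_pderivP; split. Qed.

Lemma jet_fun_intro f df (A : {fset nat * nat}) : (forall z, is_pderiv z f (df z)) ->
  (forall k, k \notin A -> forall J,
     df (Ju k.1 k.2) J = 0 /\ df (Jv k.1 k.2) J = 0) -> jet_fun f.
Proof.
move=> hf hA; split=> [z|]; first by have /is_pderivP[] := hf z.
exists A => k kA J.
by rewrite (pderivE (hf (Ju k.1 k.2))) (pderivE (hf (Jv k.1 k.2))); apply: hA.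
Qed.

Lemma jet_funD f g : jet_fun f -> jet_fun g -> jet_fun (fun J => f J + g J).
Proof.
move=> hf hg; have [_ [A hA]] := hf; have [_ [B hB]] := hg.
apply: (@jet_fun_intro _ (fun z J => pderiv z f J + pderiv z g J) (A `|` B)%fset).
  by move=> z; apply: is_pderivD; apply: jet_fun_is_pderiv.
move=> k; rewrite inE negb_or => /andP[kA kB] J.
by have [-> ->] := hA _ kA J; have [-> ->] := hB _ kB J; rewrite addr0.
Qed.

Lemma jet_funM f g : jet_fun f -> jet_fun g -> jet_fun (fun J => f J * g J).
Proof.
move=> hf hg; have [_ [A hA]] := hf; have [_ [B hB]] := hg.
apply: (@jet_fun_intro _ (fun z J => pderiv z f J * g J + f J * pderiv z g J)
          (A `|` B)%fset).
  by move=> z; apply: is_pderivM; apply: jet_fun_is_pderiv.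
move=> k; rewrite inE negb_or => /andP[kA kB] J.
have [-> ->] := hA _ kA J; have [-> ->] := hB _ kB J.
by rewrite mul0r mulr0 addr0.
Qed.

Lemma jet_fun_cst (c : R) : jet_fun (fun=> c).
Proof.
by apply: (@jet_fun_intro _ (fun _ _ => 0) fset0) => // z; apply: is_pderiv_cst.
Qed.

Lemma jet_fun_coord z : jet_fun (fun J => J z).
Proof.
apply: (@jet_fun_intro _ (fun w _ => (w == z)%:R)
  (if z is Ju i j then [fset (i, j)] else if z is Jv i j then [fset (i, j)]
   else fset0)%fset).
  by move=> w; apply: is_pderiv_coord.
move=> [i j] /= ijA J.
split; case: eqP => // ez; by rewrite -ez in_fset1 eqxx in ijA.
Qed.

Definition base_coord (z : jvar) : option bvar :=
  match z with
  | Jt => Some Bt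
  | Jx => Some Bx
  | Ju 0 0 => Some Bu
  | Jv 0 0 => Some Bv
  | _ => None
  end.

Lemma jbase_upd J z s : jbase (upd J z s) =
  if base_coord z is Some w then upd (jbase J) w s else jbase J.
Proof.
apply/funext => y.
move: z => [||i j|i j] /=; do 2?[case: i => [|i] /=]; do 2?[case: j => [|j] /=];
by case: y => /=; rewrite ?dfwithin ?dfwithout.
Qed.

Lemma is_pderiv_base z h : smooth h -> is_pderiv z (fun J => h (jbase J))
  (fun J => if base_coord z is Some w then pderiv w h (jbase J) else 0).
Proof.
move=> sh J; under eq_fun do rewrite jbase_upd.
case Ew: (base_coord z) => [w|]; last exact: is_derive_cst.
have := smooth_is_pderiv w sh (jbase J).
suff -> : jbase J w = J z by [].
by move: z Ew => [||[|?] [|?]|[|?] [|?]] //= [<-].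
Qed.

Lemma pderiv_base z h J : smooth h -> pderiv z (fun J => h (jbase J)) J =
  if base_coord z is Some w then pderiv w h (jbase J) else 0.
Proof. by move=> sh; rewrite (pderivE (is_pderiv_base z sh)). Qed.

Lemma jet_fun_base h : smooth h -> jet_fun (fun J => h (jbase J)).
Proof.
move=> sh; apply: (jet_fun_intro (A := [fset (0, 0)]%fset)
                    (fun z => is_pderiv_base z sh)).
by case=> [[|i] [|j]]; rewrite ?in_fset1 ?eqxx.
Qed.

Section TotalDerivative.
Variable d : bool.

Let z0 := if d then Jx else Jt.
Let sh (k : nat * nat) := if d then (k.1, k.2.+1) else (k.1.+1, k.2).

(** [Dx] for [d = true], [Dt] for [d = false]. *)
Definition tderiv f J :=
  pderiv z0 f J +
  \sum_(k \in [set: nat * nat])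
    (J (Ju (sh k).1 (sh k).2) * pderiv (Ju k.1 k.2) f J +
     J (Jv (sh k).1 (sh k).2) * pderiv (Jv k.1 k.2) f J).

(** As with [is_pderiv], membership in the class is carried along, because
total derivatives are iterated. *)
Definition is_tderiv f f' := jet_fun f /\ tderiv f = f'.

(** The summation set can be enlarged at will, which lets the sums of two
functions with different supports be added termwise. *)
Lemma tderiv_finE f (A : {fset nat * nat}) J :
  (forall k, k \notin A ->
    pderiv (Ju k.1 k.2) f J = 0 /\ pderiv (Jv k.1 k.2) f J = 0) ->
  tderiv f J = pderiv z0 f J + \sum_(k <- A)
    (J (Ju (sh k).1 (sh k).2) * pderiv (Ju k.1 k.2) f J +
     J (Jv (sh k).1 (sh k).2) * pderiv (Jv k.1 k.2) f J).
Proof.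
move=> hA; rewrite /tderiv (fsbigTE A) // => k /hA[-> ->].
by rewrite !mulr0 addr0.
Qed.

Lemma is_tderiv_ext f f' g' : f' =1 g' -> is_tderiv f f' -> is_tderiv f g'.
Proof. by move=> /funext->. Qed.

Lemma is_tderivD f g f' g' : is_tderiv f f' -> is_tderiv g g' ->
  is_tderiv (fun J => f J + g J) (fun J => f' J + g' J).
Proof.
move=> [hf <-] [hg <-]; split; first exact: jet_funD.
apply/funext => J.
have E z := pderivE (is_pderivD (jet_fun_is_pderiv z hf) (jet_fun_is_pderiv z hg)).
have [_ [A hA]] := hf; have [_ [B hB]] := hg.
rewrite !(@tderiv_finE _ (A `|` B)%fset) => [|k|k|k].
- rewrite E addrACA -big_split; congr (_ + _); apply: eq_bigr => k _ /=.
  by rewrite !E; ring.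
- by rewrite inE negb_or => /andP[_ /hB].
- by rewrite inE negb_or => /andP[/hA].
rewrite inE negb_or !E => /andP[/hA/(_ J)[-> ->] /hB/(_ J)[-> ->]].
by rewrite addr0.
Qed.

Lemma is_tderivM f g f' g' : is_tderiv f f' -> is_tderiv g g' ->
  is_tderiv (fun J => f J * g J) (fun J => f' J * g J + f J * g' J).
Proof.
move=> [hf <-] [hg <-]; split; first exact: jet_funM.
apply/funext => J.
have E z := pderivE (is_pderivM (jet_fun_is_pderiv z hf) (jet_fun_is_pderiv z hg)).
have [_ [A hA]] := hf; have [_ [B hB]] := hg.
rewrite !(@tderiv_finE _ (A `|` B)%fset) => [|k|k|k].
- rewrite E mulrDl mulrDr addrACA mulr_suml mulr_sumr -big_split.
  congr (_ + _); apply: eq_bigr => k _ /=.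
  by rewrite !E; ring.
- by rewrite inE negb_or => /andP[_ /hB].
- by rewrite inE negb_or => /andP[/hA].
rewrite inE negb_or !E => /andP[/hA/(_ J)[-> ->] /hB/(_ J)[-> ->]].
by rewrite mul0r mulr0 addr0.
Qed.

Lemma is_tderiv_cst (c : R) : is_tderiv (fun=> c) (fun=> 0).
Proof.
split; first exact: jet_fun_cst.
apply/funext => J; rewrite (@tderiv_finE _ fset0) ?big_nil ?pderiv_cst0 ?addr0 //.
by move=> k _; rewrite !pderiv_cst0.
Qed.

Lemma is_tderivN f f' : is_tderiv f f' -> is_tderiv (fun J => - f J) (fun J => - f' J).
Proof.
move=> ff'; have := is_tderivM (is_tderiv_cst (-1)) ff'.
rewrite (_ : (fun J => -1 * f J) = fun J => - f J).
  by apply: is_tderiv_ext => J; rewrite mul0r add0r mulN1r.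
by apply/funext => J; rewrite mulN1r.
Qed.

Lemma is_tderiv_base h : smooth h -> is_tderiv (fun J => h (jbase J))
  (fun J => pderiv (if d then Bx else Bt) h (jbase J)
    + J (Ju (sh (0, 0)).1 (sh (0, 0)).2)%N * pderiv Bu h (jbase J)
    + J (Jv (sh (0, 0)).1 (sh (0, 0)).2)%N * pderiv Bv h (jbase J)).
Proof.
move=> hs; split; first exact: jet_fun_base.
apply/funext => J; rewrite (@tderiv_finE _ [fset (0, 0)]%fset).
  rewrite big_seq_fset1 !pderiv_base //= addrA.
  by congr (_ + _ + _); rewrite /z0; case: d.
by case=> [[|i] [|j]]; rewrite ?in_fset1 ?eqxx // !pderiv_base.
Qed.

Lemma is_tderiv_coord_u i j : is_tderiv (fun J => J (Ju i j))
  (fun J => J (Ju (sh (i, j)).1 (sh (i, j)).2)).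
Proof.
split; first exact: jet_fun_coord.
have E z := pderivE (@is_pderiv_coord R jvar z (Ju i j)).
apply/funext => J; rewrite (@tderiv_finE _ [fset (i, j)]%fset).
  rewrite big_seq_fset1 !E eqxx mulr1 mulr0 addr0 /z0.
  by case: d; rewrite add0r.
move=> [k l]; rewrite in_fset1 !E => kl; split => //=.
by case: eqP => // -[ek el]; rewrite ek el eqxx in kl.
Qed.

Lemma is_tderiv_coord_v i j : is_tderiv (fun J => J (Jv i j))
  (fun J => J (Jv (sh (i, j)).1 (sh (i, j)).2)).
Proof.
split; first exact: jet_fun_coord.
have E z := pderivE (@is_pderiv_coord R jvar z (Jv i j)).
apply/funext => J; rewrite (@tderiv_finE _ [fset (i, j)]%fset).
  rewrite big_seq_fset1 !E eqxx mulr1 mulr0 add0r /z0.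
  by case: d; rewrite add0r.
move=> [k l]; rewrite in_fset1 !E => kl; split => //=.
by case: eqP => // -[ek el]; rewrite ek el eqxx in kl.
Qed.

End TotalDerivative.

Lemma DxP f f' : is_tderiv true f f' -> Dx f = f'.
Proof. by case. Qed.

Lemma DtP f f' : is_tderiv false f f' -> Dt f = f'.
Proof. by case. Qed.

End JetCalculus.

(** * Prolongation to third order *)

Section ProlongationDefinitions.
Variable R : realType.
Implicit Types (h W T X : (bvar -> R) -> R) (J : jet R) (e : bool).

(** [D1], [D2], [D3] are D_x, D_x^2 and D_x^3 of a function of (t, x, u, v).
The recursion keeps mixed derivatives in the order in which they arise. *)
Definition D1 h J :=
  pderiv Bx h (jbase J) + J (Ju 0 1) * pderiv Bu h (jbase J)
  + J (Jv 0 1) * pderiv Bv h (jbase J).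

Definition D2 h J :=
  D1 (pderiv Bx h) J + J (Ju 0 1) * D1 (pderiv Bu h) J
  + J (Jv 0 1) * D1 (pderiv Bv h) J
  + J (Ju 0 2) * pderiv Bu h (jbase J) + J (Jv 0 2) * pderiv Bv h (jbase J).

Definition D3 h J :=
  D2 (pderiv Bx h) J + J (Ju 0 1) * D2 (pderiv Bu h) J
  + J (Jv 0 1) * D2 (pderiv Bv h) J
  + 2 * J (Ju 0 2) * D1 (pderiv Bu h) J + 2 * J (Jv 0 2) * D1 (pderiv Bv h) J
  + J (Ju 0 3) * pderiv Bu h (jbase J) + J (Jv 0 3) * pderiv Bv h (jbase J).

Definition Dt1 h J :=
  pderiv Bt h (jbase J) + J (Ju 1 0) * pderiv Bu h (jbase J)
  + J (Jv 1 0) * pderiv Bv h (jbase J).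

(** The equations for u and v are treated together: [e] selects the dependent
variable w, which is u for [false] and v for [true]. *)
Definition jw e i j := if e then Jv i j else Ju i j.

Definition dep e := if e then Bv else Bu.

(** [charac] is the characteristic W - T w_t - X w_x, and [prol] the component
of the prolongation along a derivative of w. *)
Definition charac e T X W J :=
  W (jbase J) - T (jbase J) * J (jw e 1 0) - X (jbase J) * J (jw e 0 1).

Definition prol e T X W i j J :=
  iter i (@Dt R) (iter j (@Dx R) (charac e T X W)) J
  + T (jbase J) * J (jw e i.+1 j) + X (jbase J) * J (jw e i j.+1).

(** w_t + h1 u_x + h2 v_x + c w_xxx *)
Definition kdv_lhs e h1 h2 (c : R) J :=
  J (jw e 1 0) + (J (Ju 0 1) * h1 (jbase J) + J (Jv 0 1) * h2 (jbase J))
  + c * J (jw e 0 3).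

Definition lie (Y : vfield R) h (q : bvar -> R) : R :=
  Y Bt q * pderiv Bt h q + Y Bx q * pderiv Bx h q + Y Bu q * pderiv Bu h q
  + Y Bv q * pderiv Bv h q.

End ProlongationDefinitions.

(** Partial derivatives are limits: left in a goal, they make the arithmetic
tactics compare their atoms by unfolding these limits. Every value is replaced
by a variable first. *)
Ltac name_values :=
  repeat match goal with
  | |- context [pderiv ?z ?h ?q] => generalize (pderiv z h q)
  | |- context [lie ?Y ?h ?q] => generalize (lie Y h q)
  | |- context [prol ?e ?T ?X ?W ?i ?j ?J] => generalize (prol e T X W i j J)
  | |- context [D1 ?h ?J] => generalize (D1 h J)
  | |- context [D2 ?h ?J] => generalize (D2 h J)
  | |- context [D3 ?h ?J] => generalize (D3 h J)
  | |- context [Dt1 ?h ?J] => generalize (Dt1 h J)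
  | |- context [?h (jbase ?J)] => generalize (h (jbase J))
  end.

Ltac value_ring := rewrite /=; name_values; intros; ring.

Section Prolongation.
Variable R : realType.
Implicit Types (h W T X : (bvar -> R) -> R) (J : jet R) (e : bool).

Lemma is_tderiv_D1 h : smooth h -> is_tderiv true (fun J => h (jbase J)) (D1 h).
Proof. exact: is_tderiv_base. Qed.

Lemma is_tderiv_Dt1 h : smooth h -> is_tderiv false (fun J => h (jbase J)) (Dt1 h).
Proof. exact: is_tderiv_base. Qed.

Lemma is_tderiv_D2 h : smooth h -> is_tderiv true (D1 h) (D2 h).
Proof.
move=> sh.
have S z := is_tderiv_D1 (smooth_pderiv z sh).
have := is_tderivD (is_tderivD (S Bx) (is_tderivM (is_tderiv_coord_u R true 0 1) (S Bu)))
  (is_tderivM (is_tderiv_coord_v R true 0 1) (S Bv)).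
by apply: is_tderiv_ext => J /=; rewrite /D2; value_ring.
Qed.

Lemma is_tderiv_D3 h : smooth h -> is_tderiv true (D2 h) (D3 h).
Proof.
move=> sh.
have S1 z := is_tderiv_D1 (smooth_pderiv z sh).
have S2 z := is_tderiv_D2 (smooth_pderiv z sh).
have cu := is_tderiv_coord_u R true; have cv := is_tderiv_coord_v R true.
have := is_tderivD (is_tderivD (is_tderivD (is_tderivD (S2 Bx)
  (is_tderivM (cu 0 1)%N (S2 Bu))) (is_tderivM (cv 0 1)%N (S2 Bv)))
  (is_tderivM (cu 0 2)%N (S1 Bu))) (is_tderivM (cv 0 2)%N (S1 Bv)).
by apply: is_tderiv_ext => J /=; rewrite /D3; value_ring.
Qed.

Lemma is_tderiv_x_jw e i j :
  is_tderiv true (fun J : jet R => J (jw e i j)) (fun J => J (jw e i j.+1)).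
Proof. by case: e; [apply: is_tderiv_coord_v|apply: is_tderiv_coord_u]. Qed.

Lemma is_tderiv_t_jw e i j :
  is_tderiv false (fun J : jet R => J (jw e i j)) (fun J => J (jw e i.+1 j)).
Proof. by case: e; [apply: is_tderiv_coord_v|apply: is_tderiv_coord_u]. Qed.

Section Formulas.
Variables (e : bool) (T X W : (bvar -> R) -> R).
Hypotheses (sT : smooth T) (sX : smooth X) (sW : smooth W).

Lemma prol00 J : prol e T X W 0 0 J = W (jbase J).
Proof. by rewrite /prol /= /charac; value_ring. Qed.

Lemma is_tderiv_charac : is_tderiv true (charac e T X W) (fun J =>
  D1 W J - (D1 T J * J (jw e 1 0) + T (jbase J) * J (jw e 1 1))
  - (D1 X J * J (jw e 0 1) + X (jbase J) * J (jw e 0 2))).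
Proof.
exact: (is_tderivD (is_tderivD (is_tderiv_D1 sW)
 (is_tderivN (is_tderivM (is_tderiv_D1 sT) (is_tderiv_x_jw e 1 0))))
 (is_tderivN (is_tderivM (is_tderiv_D1 sX) (is_tderiv_x_jw e 0 1)))).
Qed.

Lemma prol01 J : prol e T X W 0 1 J =
  D1 W J - D1 T J * J (jw e 1 0) - D1 X J * J (jw e 0 1).
Proof. by rewrite /prol /= (DxP is_tderiv_charac); value_ring. Qed.

Lemma prol10 J : prol e T X W 1 0 J =
  Dt1 W J - Dt1 T J * J (jw e 1 0) - Dt1 X J * J (jw e 0 1).
Proof.
have H := is_tderivD (is_tderivD (is_tderiv_Dt1 sW)
 (is_tderivN (is_tderivM (is_tderiv_Dt1 sT) (is_tderiv_t_jw e 1 0))))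
 (is_tderivN (is_tderivM (is_tderiv_Dt1 sX) (is_tderiv_t_jw e 0 1))).
by rewrite /prol /= (DtP H); value_ring.
Qed.

(** In D_x^3 (W - T w_t - X w_x) the term where all derivatives fall on w_t
and the one where all fall on w_x cancel against the transport terms of the
prolongation. *)
Lemma prol03 J : prol e T X W 0 3 J =
  D3 W J - 3 * D1 T J * J (jw e 1 2) - 3 * D2 T J * J (jw e 1 1)
  - D3 T J * J (jw e 1 0)
  - 3 * D1 X J * J (jw e 0 3) - 3 * D2 X J * J (jw e 0 2)
  - D3 X J * J (jw e 0 1).
Proof.
have E1 := DxP is_tderiv_charac.
have jx := is_tderiv_x_jw e.
have T0 := is_tderiv_D1 sT; have X0 := is_tderiv_D1 sX.
have T1 := is_tderiv_D2 sT; have X1 := is_tderiv_D2 sX; have W1 := is_tderiv_D2 sW.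
have T2 := is_tderiv_D3 sT; have X2 := is_tderiv_D3 sX; have W2 := is_tderiv_D3 sW.
have E2 : Dx (Dx (charac e T X W)) = fun J =>
    D2 W J - (D2 T J * J (jw e 1 0) + 2 * D1 T J * J (jw e 1 1)
              + T (jbase J) * J (jw e 1 2))
    - (D2 X J * J (jw e 0 1) + 2 * D1 X J * J (jw e 0 2)
              + X (jbase J) * J (jw e 0 3)).
  rewrite E1; apply: DxP.
  have := is_tderivD (is_tderivD W1 (is_tderivN (is_tderivD
    (is_tderivM T1 (jx 1 0)) (is_tderivM T0 (jx 1 1)))))%N
    (is_tderivN (is_tderivD (is_tderivM X1 (jx 0 1)) (is_tderivM X0 (jx 0 2)))%N).
  by apply: is_tderiv_ext => K /=; value_ring.
have two := is_tderiv_cst true (2 : R).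
have E3 : is_tderiv true (fun J =>
    D2 W J - (D2 T J * J (jw e 1 0) + 2 * D1 T J * J (jw e 1 1)
              + T (jbase J) * J (jw e 1 2))
    - (D2 X J * J (jw e 0 1) + 2 * D1 X J * J (jw e 0 2)
              + X (jbase J) * J (jw e 0 3)))
   (fun J => D3 W J - (D3 T J * J (jw e 1 0) + 3 * D2 T J * J (jw e 1 1)
      + 3 * D1 T J * J (jw e 1 2) + T (jbase J) * J (jw e 1 3))
    - (D3 X J * J (jw e 0 1) + 3 * D2 X J * J (jw e 0 2)
      + 3 * D1 X J * J (jw e 0 3) + X (jbase J) * J (jw e 0 4))).
  have := is_tderivD (is_tderivD W2 (is_tderivN (is_tderivD (is_tderivD
    (is_tderivM T2 (jx 1 0)) (is_tderivM (is_tderivM two T1) (jx 1 1)))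
    (is_tderivM T0 (jx 1 2)))))%N
    (is_tderivN (is_tderivD (is_tderivD (is_tderivM X2 (jx 0 1))
      (is_tderivM (is_tderivM two X1) (jx 0 2))) (is_tderivM X0 (jx 0 3)))%N).
  by apply: is_tderiv_ext => K /=; value_ring.
by rewrite /prol /= E2 (DxP E3); value_ring.
Qed.

End Formulas.

Lemma pr_uE (Y : vfield R) i j : pr_u Y i j = prol false (Y Bt) (Y Bx) (Y Bu) i j.
Proof. by []. Qed.

Lemma pr_vE (Y : vfield R) i j : pr_v Y i j = prol true (Y Bt) (Y Bx) (Y Bv) i j.
Proof. by []. Qed.

Lemma pderiv_kdv_lhs e h1 h2 c z J : smooth h1 -> smooth h2 ->
  pderiv z (kdv_lhs e h1 h2 c) J =
   (z == jw e 1 0)%:R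
   + ((z == Ju 0 1)%:R * h1 (jbase J) + J (Ju 0 1) *
       (if base_coord z is Some w then pderiv w h1 (jbase J) else 0)
      + ((z == Jv 0 1)%:R * h2 (jbase J) + J (Jv 0 1) *
       (if base_coord z is Some w then pderiv w h2 (jbase J) else 0)))
   + (0 * J (jw e 0 3) + c * (z == jw e 0 3)%:R).
Proof.
move=> s1 s2.
have C w := @is_pderiv_coord R _ z w.
by rewrite (pderivE (is_pderivD (is_pderivD (C (jw e 1 0)%N)
  (is_pderivD (is_pderivM (C (Ju 0 1)) (is_pderiv_base z s1))
              (is_pderivM (C (Jv 0 1)) (is_pderiv_base z s2))))
  (is_pderivM (is_pderiv_cst z c) (C (jw e 0 3)%N)))).
Qed.

Lemma pr3_kdv (Y : vfield R) e h1 h2 c J : smooth h1 -> smooth h2 ->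
  pr3 Y (kdv_lhs e h1 h2 c) J =
  prol e (Y Bt) (Y Bx) (Y (dep e)) 1 0 J
  + h1 (jbase J) * prol false (Y Bt) (Y Bx) (Y Bu) 0 1 J
  + h2 (jbase J) * prol true (Y Bt) (Y Bx) (Y Bv) 0 1 J
  + J (Ju 0 1) * lie Y h1 (jbase J) + J (Jv 0 1) * lie Y h2 (jbase J)
  + c * prol e (Y Bt) (Y Bx) (Y (dep e)) 0 3 J.
Proof.
move=> s1 s2; rewrite /pr3; under eq_bigr do rewrite big_mkcond.
rewrite !big_ord_recr !big_ord0 /= !pderiv_kdv_lhs //.
(* Comparing codes makes the equality tests between jet coordinates compute. *)
have Eb (z w : jvar) : (z == w) = (jvar_code z == jvar_code w) by [].
rewrite !pr_uE !pr_vE !prol00 /lie.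
case: e; rewrite !Eb /jw /dep; value_ring.
Qed.

End Prolongation.

(** * Extraction of the determining equations *)

Section DeterminingEquations.
Variable R : realType.
Implicit Types (h W : (bvar -> R) -> R) (J : jet R) (q : bvar -> R).

Lemma D_of_t h : (forall z, z != Bt -> pderiv z h = (fun=> 0)) ->
  [/\ D1 h = (fun=> 0), D2 h = (fun=> 0) & D3 h = (fun=> 0)].
Proof.
move=> h0.
have D10 k : (forall z, z != Bt -> pderiv z k = (fun=> 0)) -> D1 k = (fun=> 0 : R).
  by move=> k0; apply/funext => J; rewrite /D1 !k0 // !mulr0 !addr0.
have D20 k : (forall z, z != Bt -> pderiv z k = (fun=> 0)) -> D2 k = (fun=> 0 : R).
  move=> k0; apply/funext => J; rewrite /D2 !k0 // D10 ?mulr0 ?addr0 // => z _.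
  exact: pderiv_cst0.
split; [exact: D10|exact: D20|].
have c0 z : z != Bt -> pderiv z (fun _ : bvar -> R => 0) = (fun=> 0 : R).
  by move=> _; apply: pderiv_cst0.
by apply/funext => J; rewrite /D3 !h0 // D20 // D10 // !mulr0 !addr0.
Qed.

Lemma D_of_tx h : smooth h -> pderiv Bu h = (fun=> 0) -> pderiv Bv h = (fun=> 0) ->
  [/\ D1 h = (fun J => pderiv Bx h (jbase J)),
      D2 h = (fun J => pderiv Bx (pderiv Bx h) (jbase J))
    & D3 h = (fun J => pderiv Bx (pderiv Bx (pderiv Bx h)) (jbase J))].
Proof.
move=> sh hu hv.
have c0 z : z != Bt -> pderiv z (fun _ : bvar -> R => 0) = (fun=> 0 : R).
  by move=> _; apply: pderiv_cst0.
have [z1 z2 _] := D_of_t c0.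
have D1x k : pderiv Bu k = (fun=> 0) -> pderiv Bv k = (fun=> 0) ->
    D1 k = (fun J : jet R => pderiv Bx k (jbase J)).
  by move=> ku kv; apply/funext => J; rewrite /D1 ku kv !mulr0 !addr0.
have xz z k : smooth k -> pderiv z k = (fun=> 0) -> pderiv z (pderiv Bx k) = (fun=> 0 : R).
  move=> sk; apply: pderiv0_pderiv => q; exact: smooth_pderivable.
have D2x k : smooth k -> pderiv Bu k = (fun=> 0) -> pderiv Bv k = (fun=> 0) ->
    D2 k = (fun J : jet R => pderiv Bx (pderiv Bx k) (jbase J)).
  move=> sk ku kv; apply/funext => J.
  by rewrite /D2 (D1x _ (xz _ _ sk ku) (xz _ _ sk kv)) ku kv z1 !mulr0 !addr0.
split; [exact: D1x|exact: D2x|].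
apply/funext => J.
rewrite /D3 (D2x _ (smooth_pderiv Bx sh) (xz _ _ sh hu) (xz _ _ sh hv)).
by rewrite hu hv z1 z2 !mulr0 !addr0.
Qed.

Definition mkjet q (ut vt u1 v1 u2 v2 u3 v3 utxx : R) : jet R := fun z =>
  match z with
  | Jt => q Bt | Jx => q Bx
  | Ju 0 0 => q Bu | Ju 0 1 => u1 | Ju 0 2 => u2 | Ju 0 3 => u3
  | Ju 1 0 => ut | Ju 1 2 => utxx
  | Jv 0 0 => q Bv | Jv 0 1 => v1 | Jv 0 2 => v2 | Jv 0 3 => v3
  | Jv 1 0 => vt
  | _ => 0
  end.

Lemma jbase_mkjet q ut vt u1 v1 u2 v2 u3 v3 utxx :
  jbase (mkjet q ut vt u1 v1 u2 v2 u3 v3 utxx) = q.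
Proof. by apply/funext; case. Qed.

(** The hypothesis is the part of D_x^3 W linear in u_xx and v_xx, where [uv]
stands for the u-derivative of the v-derivative of W, and so on. The products
u_x v_xx and v_x u_xx have coefficients 2 uv + vu and uv + 2 vu, so that both
orders of differentiation vanish. *)
Lemma mixed_coef (ux xu vx xv uu uv vu vv : R) :
  (forall u1 v1 u2 v2 : R,
    u2 * (ux + u1 * uu + v1 * uv + 2 * (xu + u1 * uu + v1 * vu))
    + v2 * (vx + u1 * vu + v1 * vv + 2 * (xv + u1 * uv + v1 * vv)) = 0) ->
  [/\ uu = 0, uv = 0, vu = 0 & vv = 0] /\ ux + 2 * xu = 0 /\ vx + 2 * xv = 0.
Proof.
move=> E.
have := E 0 0 1 0; have := E 1 0 1 0; have := E 0 1 1 0.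
have := E 0 0 0 1; have := E 1 0 0 1; have := E 0 1 0 1.
by move=> e1 e2 e3 e4 e5 e6; repeat split; lra.
Qed.

(** By [mixed_coef] W is affine in (u, v). Then its x-u and u-x derivatives
agree by [pderivC_affine], and the coefficient of u_xx, which is three times
their common value, makes them vanish; likewise for v. *)
Lemma affine_of_D3 W : smooth W ->
  (forall q u1 v1 u2 v2, D3 W (mkjet q 0 0 u1 v1 u2 v2 0 0 0)
                       = D3 W (mkjet q 0 0 u1 v1 0 0 0 0 0)) ->
  forall z w, z \in [:: Bu; Bv] -> w \in [:: Bx; Bu; Bv] ->
    pderiv w (pderiv z W) = (fun=> 0) /\ pderiv z (pderiv w W) = (fun=> 0).
Proof.
move=> sW HW.
have H q u1 v1 u2 v2 := HW q u1 v1 u2 v2.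
rewrite /D3 /D2 /D1 in H.
have /= {}H q u1 v1 u2 v2 := H q u1 v1 u2 v2.
pose P z w q := pderiv z (pderiv w W) q.
have {H}E q := @mixed_coef (P Bu Bx q) (P Bx Bu q) (P Bv Bx q) (P Bx Bv q)
  (P Bu Bu q) (P Bu Bv q) (P Bv Bu q) (P Bv Bv q) (fun u1 v1 u2 v2 =>
   ltac:(have := H q u1 v1 u2 v2; rewrite /P !jbase_mkjet;
     repeat match goal with
     | |- context [pderiv ?z ?h ?q] => generalize (pderiv z h q)
     end; intros; lra)).
have nul z w : (forall q, P z w q = 0) -> pderiv z (pderiv w W) = (fun=> 0).
  by move=> H; apply/funext => q; apply: H.
have uu := nul Bu Bu (fun q => let: And4 h _ _ _ := (E q).1 in h).
have uv := nul Bu Bv (fun q => let: And4 _ h _ _ := (E q).1 in h).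
have vu := nul Bv Bu (fun q => let: And4 _ _ h _ := (E q).1 in h).
have vv := nul Bv Bv (fun q => let: And4 _ _ _ h := (E q).1 in h).
have Eu : pderiv Bu (pderiv Bx W) = pderiv Bx (pderiv Bu W).
  exact: pderivC_affine.
have Ev : pderiv Bv (pderiv Bx W) = pderiv Bx (pderiv Bv W).
  exact: pderivC_affine.
have three (x : R) : x + 2 * x = 0 -> x = 0 by move=> ?; lra.
have xu : pderiv Bx (pderiv Bu W) = (fun=> 0).
  by apply: nul => q; apply: three; have [_ [+ _]] := E q; rewrite {1}/P Eu.
have xv : pderiv Bx (pderiv Bv W) = (fun=> 0).
  by apply: nul => q; apply: three; have [_ [_]] := E q; rewrite {1}/P Ev.
move=> z w; rewrite !inE => /orP[] /eqP -> /or3P[] /eqP ->.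
- by rewrite Eu; split; exact: xu.
- by split; exact: uu.
- by split; [exact: vu|exact: uv].
- by rewrite Ev; split; exact: xv.
- by split; [exact: uv|exact: vu].
- by split; exact: vv.
Qed.

End DeterminingEquations.

(** * The form of a symmetry *)

Section Symmetry.
Variables (R : realType) (Y : vfield R) (f1 f2 g1 g2 : (bvar -> R) -> R) (c : R).
Implicit Types (J : jet R) (q : bvar -> R).
Hypotheses (sY : forall z, smooth (Y z)).
Hypotheses (sf1 : smooth f1) (sf2 : smooth f2) (sg1 : smooth g1) (sg2 : smooth g2).
Hypothesis c0 : c != 0.

Local Notation T := (Y Bt).
Local Notation X := (Y Bx).
Local Notation U := (Y Bu).
Local Notation V := (Y Bv).

Definition coef_u e := if e then g1 else f1.
Definition coef_v e := if e then g2 else f2.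

Lemma pr3_kdv_explicit e J :
  pr3 Y (kdv_lhs e (coef_u e) (coef_v e) c) J =
  Dt1 (Y (dep e)) J - Dt1 T J * J (jw e 1 0) - Dt1 X J * J (jw e 0 1)
  + coef_u e (jbase J) * (D1 U J - D1 T J * J (Ju 1 0) - D1 X J * J (Ju 0 1))
  + coef_v e (jbase J) * (D1 V J - D1 T J * J (Jv 1 0) - D1 X J * J (Jv 0 1))
  + J (Ju 0 1) * lie Y (coef_u e) (jbase J) + J (Jv 0 1) * lie Y (coef_v e) (jbase J)
  + c * (D3 (Y (dep e)) J - 3 * D1 T J * J (jw e 1 2) - 3 * D2 T J * J (jw e 1 1)
         - D3 T J * J (jw e 1 0) - 3 * D1 X J * J (jw e 0 3)
         - 3 * D2 X J * J (jw e 0 2) - D3 X J * J (jw e 0 1)).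
Proof.
have s1 : smooth (coef_u e) by case: (e).
have s2 : smooth (coef_v e) by case: (e).
by rewrite pr3_kdv // prol10 // !prol01 // prol03.
Qed.

Definition invariant := forall J,
  (forall e, kdv_lhs e (coef_u e) (coef_v e) c J = 0) ->
  forall e, pr3 Y (kdv_lhs e (coef_u e) (coef_v e) c) J = 0.

Hypothesis inv : invariant.

(** Jets solving both equations: u_t and v_t are determined by the other
coordinates, while u_txx stays free, as the equations are not differentiated.
The coordinate v_xxx and the other mixed derivatives are set to 0. *)
Definition soljet q u1 v1 u2 v2 u3 utxx := mkjet q
  (- (u1 * f1 q + v1 * f2 q) - c * u3) (- (u1 * g1 q + v1 * g2 q))
  u1 v1 u2 v2 u3 0 utxx.

Lemma inv_soljet e q u1 v1 u2 v2 u3 utxx :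
  pr3 Y (kdv_lhs e (coef_u e) (coef_v e) c) (soljet q u1 v1 u2 v2 u3 utxx) = 0.
Proof.
apply: inv => e'.
by rewrite /kdv_lhs jbase_mkjet; case: e' => /=; ring.
Qed.

(** On solution jets u_txx only occurs with the factor -3 c D_x T. *)
Lemma sym_T_of_t z : z != Bt -> pderiv z T = (fun=> 0).
Proof.
move=> zt; have D1T0 q u1 v1 : D1 T (soljet q u1 v1 0 0 0 0) = 0.
  pose S := soljet q u1 v1 0 0 0.
  have E1 := @inv_soljet false q u1 v1 0 0 0 1.
  have E0 := @inv_soljet false q u1 v1 0 0 0 0.
  rewrite -/S !pr3_kdv_explicit in E0 E1 *.
  have i1 h : D1 h (S 1) = D1 h (S 0) by [].
  have i2 h : D2 h (S 1) = D2 h (S 0) by [].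
  have i3 h : D3 h (S 1) = D3 h (S 0) by [].
  have it h : Dt1 h (S 1) = Dt1 h (S 0) by [].
  have ib : jbase (S 1) = jbase (S 0) by rewrite !jbase_mkjet.
  rewrite !i1 !i2 !i3 !it !ib /= in E1; rewrite /= in E0.
  apply: (mul0_cancel _ _ c0).
  by move: E0 E1; name_values; intros; lra.
apply/funext => q.
have := D1T0 q 0 0; have := D1T0 q 1 0; have := D1T0 q 0 1.
rewrite /D1 !jbase_mkjet /=.
by case: z zt => // _; name_values; intros; lra.
Qed.

(** In the equation for u the term -3 c D_x^2 X u_xx is the only one
quadratic in the second derivatives. *)
Lemma sym_X_of_tx z : z \in [:: Bu; Bv] -> pderiv z X = (fun=> 0).
Proof.
have [T1 T2 T3] := D_of_t sym_T_of_t.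
move=> zuv; apply/funext => q.
have E s r := @inv_soljet false q 0 0 s r 0 0.
have {}E s r : pderiv Bt U q + f1 q * pderiv Bx U q + f2 q * pderiv Bx V q
   + c * (pderiv Bx (pderiv Bx (pderiv Bx U)) q
   + s * pderiv Bu (pderiv Bx U) q + r * pderiv Bv (pderiv Bx U) q
   + 2 * s * pderiv Bx (pderiv Bu U) q + 2 * r * pderiv Bx (pderiv Bv U) q
   - 3 * s * (pderiv Bx (pderiv Bx X) q + s * pderiv Bu X q + r * pderiv Bv X q)) = 0.
  apply: etrans (E s r).
  rewrite pr3_kdv_explicit T1 T2 T3 /D3 /Dt1 /D2 /D1 /= !jbase_mkjet.
  by name_values; move: (f1 q) (f2 q); intros; ring.
move: zuv; rewrite !inE => /orP[] /eqP ->; apply: (mul0_cancel _ _ c0).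
- have := E 0 0; have := E 1 0; have := E (-1) 0.
  by name_values; move: (f1 q) (f2 q); intros; lra.
- have := E 0 0; have := E 1 0; have := E 0 1; have := E 1 1.
  by name_values; move: (f1 q) (f2 q); intros; lra.
Qed.

(** Coefficient of u_xxx, taking into account that u_t contains -c u_xxx. The
contributions of U_u cancel. *)
Lemma sym_Tt_Xx q : pderiv Bt T q = 3 * pderiv Bx X q.
Proof.
have [T1 T2 T3] := D_of_t sym_T_of_t.
have [X1 X2 X3] := D_of_tx (sY Bx) (@sym_X_of_tx Bu isT) (@sym_X_of_tx Bv isT).
have E k := @inv_soljet false q 0 0 0 0 k 0.
have {}E k : pderiv Bt U q - c * k * pderiv Bu U q + c * k * pderiv Bt T q
    + f1 q * pderiv Bx U q + f2 q * pderiv Bx V q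
    + c * (pderiv Bx (pderiv Bx (pderiv Bx U)) q + k * pderiv Bu U q
           - 3 * k * pderiv Bx X q) = 0.
  apply: etrans (E k).
  rewrite pr3_kdv_explicit T1 T2 T3 X1 X2 X3 /D3 /Dt1 /D2 /D1 /= !jbase_mkjet.
  rewrite !(@sym_T_of_t Bu, @sym_T_of_t Bv) //.
  by name_values; move: (f1 q) (f2 q) (g1 q) (g2 q); intros; ring.
apply/eqP; rewrite -subr_eq0; apply/eqP.
apply: (mul0_cancel _ _ c0); have := E 0; have := E 1.
by name_values; move: (f1 q) (f2 q); intros; lra.
Qed.

Lemma sym_Xxx : pderiv Bx (pderiv Bx X) = (fun=> 0).
Proof.
have sXx := smooth_pderiv Bx (sY Bx).
have : pderiv Bx (pderiv Bt T) = (fun=> 0).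
  by apply: pderiv0_pderiv (sym_T_of_t _) => // q; apply: smooth_pderivable.
rewrite (_ : pderiv Bt T = fun q => 3 * pderiv Bx X q); last exact/funext/sym_Tt_Xx.
rewrite (pderivE (is_pderivM (is_pderiv_cst Bx 3) (smooth_is_pderiv Bx sXx))).
move=> E; apply/funext => q; have := congr1 (fun h => h q) E.
by rewrite /= mul0r add0r => /eqP; rewrite mulf_eq0 pnatr_eq0 => /eqP.
Qed.

(** Once T and X are reduced, second derivatives of u and v only occur in
c D_x^3 U, respectively c D_x^3 V. *)
Lemma sym_UV_affine e z w : z \in [:: Bu; Bv] -> w \in [:: Bx; Bu; Bv] ->
  pderiv w (pderiv z (Y (dep e))) = (fun=> 0) /\
  pderiv z (pderiv w (Y (dep e))) = (fun=> 0).
Proof.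
have [T1 T2 T3] := D_of_t sym_T_of_t.
have [X1 X2 X3] := D_of_tx (sY Bx) (@sym_X_of_tx Bu isT) (@sym_X_of_tx Bv isT).
apply: (affine_of_D3 (sY (dep e))) => q u1 v1 u2 v2.
pose S u2 v2 := soljet q u1 v1 u2 v2 0 0.
have E2 := @inv_soljet e q u1 v1 u2 v2 0 0.
have E0 := @inv_soljet e q u1 v1 0 0 0 0.
change (D3 (Y (dep e)) (S u2 v2) = D3 (Y (dep e)) (S 0 0)).
rewrite -/(S 0 0) pr3_kdv_explicit in E0; rewrite -/(S u2 v2) pr3_kdv_explicit in E2.
rewrite T1 T2 T3 X1 X2 X3 sym_Xxx pderiv_cst0 in E0 E2.
have i1 h : D1 h (S u2 v2) = D1 h (S 0 0) by [].
have it h : Dt1 h (S u2 v2) = Dt1 h (S 0 0) by [].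
have ib : jbase (S u2 v2) = jbase (S 0 0) by rewrite !jbase_mkjet.
have iz : [/\ S u2 v2 (jw e 1 0)%N = S 0 0 (jw e 1 0)%N,
   S u2 v2 (jw e 0 1)%N = S 0 0 (jw e 0 1)%N & S u2 v2 (jw e 0 3)%N = S 0 0 (jw e 0 3)%N].
  by rewrite /jw; case: (e).
have [iz1 iz2 iz3] := iz.
have iu : S u2 v2 (Ju 0 1) = S 0 0 (Ju 0 1) by [].
have iv : S u2 v2 (Jv 0 1) = S 0 0 (Jv 0 1) by [].
rewrite !it !i1 !ib !iz1 !iz2 !iz3 iu iv !mul0r in E2; rewrite !mul0r in E0.
apply/eqP; rewrite -subr_eq0; apply/eqP; apply: (mul0_cancel _ _ c0).
move: E0 E2; name_values.
move: (S 0 0 (jw e 1 0)%N) (S 0 0 (jw e 0 1)%N) (S 0 0 (jw e 0 3)%N).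
move: (S 0 0 (Ju 0 1)) (S 0 0 (Jv 0 1)).
by intros; lra.
Qed.

(** The remaining identity, for u_xx = v_xx = 0 and the two third derivatives
0: D_x^3 W is then W_xxx, and T_t has been replaced by 3 X_x. *)
Lemma sym_first_order e q u1 v1 :
  let W := Y (dep e) in let h1 := coef_u e q in let h2 := coef_v e q in
  pderiv Bt W q
  - pderiv Bu W q * (u1 * f1 q + v1 * f2 q) - pderiv Bv W q * (u1 * g1 q + v1 * g2 q)
  + 3 * pderiv Bx X q * (u1 * h1 + v1 * h2) - pderiv Bt X q * (if e then v1 else u1)
  + h1 * (pderiv Bx U q + u1 * pderiv Bu U q + v1 * pderiv Bv U q - u1 * pderiv Bx X q)
  + h2 * (pderiv Bx V q + u1 * pderiv Bu V q + v1 * pderiv Bv V q - v1 * pderiv Bx X q)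
  + u1 * lie Y (coef_u e) q + v1 * lie Y (coef_v e) q
  + c * pderiv Bx (pderiv Bx (pderiv Bx W)) q = 0.
Proof.
move=> W h1 h2.
have [T1 T2 T3] := D_of_t sym_T_of_t.
have [X1 X2 X3] := D_of_tx (sY Bx) (@sym_X_of_tx Bu isT) (@sym_X_of_tx Bv isT).
have D2z z : z \in [:: Bu; Bv] -> D2 (pderiv z W) = (fun=> 0).
  move=> zuv; have [] := @D_of_t _ (pderiv z W).
    by move=> w wt; apply: (sym_UV_affine e zuv _).1; case: w wt.
  by [].
have [_ D2x _] := D_of_tx (smooth_pderiv Bx (sY (dep e)))
  (@sym_UV_affine e Bu Bx isT isT).2 (@sym_UV_affine e Bv Bx isT isT).2.
apply: etrans (@inv_soljet e q u1 v1 0 0 0 0).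
rewrite pr3_kdv_explicit T1 T2 T3 X1 X2 X3 /D3 /Dt1 -/W.
rewrite (D2z Bu isT) (D2z Bv isT) D2x /D1 !jbase_mkjet.
rewrite sym_Xxx pderiv_cst0 !(@sym_T_of_t Bu, @sym_T_of_t Bv) //.
rewrite !(@sym_X_of_tx Bu, @sym_X_of_tx Bv) //.
rewrite sym_Tt_Xx -/h1 -/h2.
have -> : soljet q u1 v1 0 0 0 0 (jw e 1 0)%N = - (u1 * h1 + v1 * h2).
  by rewrite /h1 /h2 /jw; case: (e) => /=; rewrite ?mulr0 ?subr0.
have -> : soljet q u1 v1 0 0 0 0 (jw e 0 1)%N = if e then v1 else u1.
  by rewrite /jw; case: (e).
have -> : soljet q u1 v1 0 0 0 0 (jw e 0 3)%N = 0 by rewrite /jw; case: (e).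
rewrite -/W /=; name_values.
move: (soljet q u1 v1 0 0 0 0 (jw e 1 2)%N) (soljet q u1 v1 0 0 0 0 (jw e 1 1)%N).
move: (soljet q u1 v1 0 0 0 0 (jw e 0 2)%N).
move: (f1 q) (f2 q) (g1 q) (g2 q) h1 h2 (if e then v1 else u1).
by intros; ring.
Qed.

End Symmetry.

(** * Algebra of the two fluxes *)

Section FluxAlgebra.
Variable R : realType.
Implicit Types (a b k chi u v s al be ga ep de ze : R).

Lemma poly_eq0 (P : {poly R}) : (forall s, P.[s] = 0) -> P = 0.
Proof.
move=> P0; apply/eqP; apply: contraT => Pn0.
have := max_poly_roots Pn0 (rs := [seq i%:R | i <- iota 0 (size P)]).
rewrite size_map size_iota ltnn; apply.
  by apply/allP => x _; apply/rootP.
by rewrite map_inj_uniq ?iota_uniq //; apply: mulrIn; rewrite oner_eq0.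
Qed.

(** With p = n + 1 the exponents are 0, p - 1, p, 2 p - 1 and 2 p. They are
distinct for p > 1; for p = 1 the first two and the next two collide. *)
Lemma five_powers n (A B C D E : R) :
  (forall s, A + B * s ^+ n + C * s ^+ n.+1 + D * s ^+ (n + n.+1)
             + E * s ^+ (n.+1 + n.+1) = 0) ->
  [/\ E = 0, (0 < n)%N -> [/\ A = 0, B = 0, C = 0 & D = 0]
    & n = 0%N -> A + B = 0 /\ C + D = 0].
Proof.
move=> H.
have P0 : A%:P + B *: 'X^n + C *: 'X^(n.+1) + D *: 'X^(n + n.+1)
             + E *: 'X^(n.+1 + n.+1) = 0.
  by apply: poly_eq0 => s; rewrite !(hornerD, hornerZ, hornerXn, hornerC) H.
have K i : A * (i == 0)%:R + B * (i == n)%:R + C * (i == n.+1)%:R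
    + D * (i == n + n.+1)%:R + E * (i == n.+1 + n.+1)%:R = 0.
  have : (0 : {poly R})`_i = 0 by rewrite coef0.
  rewrite -P0 !(coefD, coefZ, coefXn, coefC) => <-.
  by case: (i == 0%N); rewrite ?mulr1 ?mulr0.
have neq (i j : nat) : (i < j)%N || (j < i)%N -> (i == j) = false.
  by move=> ij; apply/eqP => ?; subst; rewrite ltnn in ij.
split.
- have := K (n.+1 + n.+1)%N; rewrite eqxx.
  by rewrite !neq ?mulr0 ?add0r ?mulr1 //; lia.
- move=> n0; split.
  + have := K 0%N; rewrite eqxx.
    by rewrite !neq ?mulr0 ?addr0 ?mulr1 //; lia.
  + have := K n; rewrite eqxx.
    by rewrite !neq ?mulr0 ?addr0 ?add0r ?mulr1 //; lia.
  + have := K n.+1; rewrite eqxx.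
    by rewrite !neq ?mulr0 ?addr0 ?add0r ?mulr1 //; lia.
  + have := K (n + n.+1)%N; rewrite eqxx.
    by rewrite !neq ?mulr0 ?addr0 ?add0r ?mulr1 //; lia.
- move=> n0; subst n.
  by have := K 0%N; have := K 1%N; rewrite /= => ? ?; split; lra.
Qed.

Section Flux.
Variables (a b : R) (n : nat).

(** With p = n + 1, let f = a (u^p + v^p) u + b (u v)^p v be the flux of the
first equation. Then [phi1] = f_u, [phi2] = f_v and [phi11], [phi12], [phi22]
are the second derivatives of f. The flux of the second equation is f with u
and v exchanged. *)
Definition phi1 u v := a * (n.+2%:R * u ^+ n.+1 + v ^+ n.+1)
  + b * (n.+1%:R * u ^+ n * v ^+ n.+2).
Definition phi2 u v := a * (n.+1%:R * u * v ^+ n)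
  + b * (n.+2%:R * u ^+ n.+1 * v ^+ n.+1).
Definition phi11 u v := a * (n.+2%:R * n.+1%:R * u ^+ n)
  + b * (n.+1%:R * (n%:R * u ^+ n.-1) * v ^+ n.+2).
Definition phi12 u v := a * (n.+1%:R * v ^+ n)
  + b * (n.+2%:R * n.+1%:R * u ^+ n * v ^+ n.+1).
Definition phi22 u v := a * (n.+1%:R * u * (n%:R * v ^+ n.-1))
  + b * (n.+2%:R * n.+1%:R * u ^+ n.+1 * v ^+ n).

(** The coefficients of u_x and v_x in the first order identity of the first
equation, for k = X_x, chi = X_t and U, V affine in (u, v). The second equation
gives the same system after exchange of (u, al, be, ga) and (v, de, ep, ze). *)
Definition flux_eqs k chi al be ga ep de ze := forall u v,
  let U := al * u + be * v + ga in let V := ep * u + de * v + ze in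
  2 * k * phi1 u v + ep * phi2 u v - be * phi2 v u
    + U * phi11 u v + V * phi12 u v - chi = 0 /\
  2 * k * phi2 u v + (de - al) * phi2 u v + be * (phi1 u v - phi1 v u)
    + U * phi12 u v + V * phi22 u v = 0.

(** The parts of degree p and 2 p in the coefficient of u_x, without their
factors a and b. *)
Definition degree_p_part al be ep de k u v :=
  2 * k * (n.+2%:R * u ^+ n.+1 + v ^+ n.+1)
  + ep * n.+1%:R * u * v ^+ n - be * n.+1%:R * v * u ^+ n
  + n.+2%:R * n.+1%:R * u ^+ n * (al * u + be * v)
  + n.+1%:R * v ^+ n * (ep * u + de * v).

Definition degree_2p_part al be ep de k u v :=
  2 * k * n.+1%:R * u ^+ n * v ^+ n.+2
  + (ep - be) * n.+2%:R * u ^+ n.+1 * v ^+ n.+1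
  + n.+1%:R * n%:R * (al * u ^+ n * v ^+ n.+2 + be * u ^+ n.-1 * v ^+ n.+3)
  + n.+2%:R * n.+1%:R * u ^+ n * v ^+ n.+1 * (ep * u + de * v).

(** Replacing (u, v) by (s u, s v) turns the coefficient of u_x into a
polynomial in s, whose coefficients are the homogeneous parts. *)
Lemma flux_eqs_homogeneous k chi al be ga ep de ze :
  flux_eqs k chi al be ga ep de ze -> forall u v,
  let A := - chi in
  let B := a * (n.+2%:R * n.+1%:R * u ^+ n * ga + n.+1%:R * v ^+ n * ze) in
  let C := a * degree_p_part al be ep de k u v in
  let D := b * (n.+1%:R * n%:R * u ^+ n.-1 * v ^+ n.+2 * ga
                + n.+2%:R * n.+1%:R * u ^+ n * v ^+ n.+1 * ze) in
  let E := b * degree_2p_part al be ep de k u v in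
  [/\ E = 0, (0 < n)%N -> [/\ A = 0, B = 0, C = 0 & D = 0]
    & n = 0%N -> A + B = 0 /\ C + D = 0].
Proof.
move=> H u v; apply: five_powers => s.
rewrite -[RHS](H (s * u) (s * v)).1 /degree_p_part /degree_2p_part /phi1 /phi2 /phi11 /phi12.
rewrite !exprMn !exprD.
by case: n => [|m]; rewrite ?mulr0n /= ?exprMn !exprS; ring.
Qed.

Definition sols_b al be ga ep de ze k chi :=
  [/\ be = 0, ep = 0, de = al & k = - (n.+1%:R * al)] /\
  [/\ a * al = 0, ga = 0, ze = 0 & chi = 0].

(** The part of degree 2 p, evaluated at (1, 1) and (-1, 1), relates the linear
parts of U and V and k. For p > 1 the remaining parts vanish separately; for
p = 1 the degrees p and 2 p - 1 coincide, and evaluation at (1, 0) and (0, 1)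
separates them. *)
Lemma flux_eqs_b k chi al be ga ep de ze : b != 0 ->
  flux_eqs k chi al be ga ep de ze -> flux_eqs k chi de ep ze be al ga ->
  sols_b al be ga ep de ze k chi.
Proof.
move=> b0 H1 H2.
have top k' al' be' ga' ep' de' ze' : flux_eqs k' chi al' be' ga' ep' de' ze' ->
    2 * k' + n%:R * al' + n.+2%:R * de' = 0 /\
    be' * (n%:R ^+ 2 - 2) + ep' * n.+2%:R ^+ 2 = 0.
  move=> H; have E1 := (flux_eqs_homogeneous H 1 1); have E2 := (flux_eqs_homogeneous H (-1) 1).
  have [{}E1 _ _] := E1; have [{}E2 _ _] := E2.
  move/eqP: E1; move/eqP: E2; rewrite !mulf_eq0 (negbTE b0) /= => /eqP E2 /eqP E1.
  have {}E1 : 2 * k' * n.+1%:R + (ep' - be') * n.+2%:R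
     + n.+1%:R * n%:R * (al' + be') + n.+2%:R * n.+1%:R * (ep' + de') = 0.
    by rewrite -[RHS]E1 /degree_2p_part !expr1n; ring.
  have {}E2 : 2 * k' * n.+1%:R - (ep' - be') * n.+2%:R
     + n.+1%:R * n%:R * (al' - be') + n.+2%:R * n.+1%:R * (- ep' + de') = 0.
    (* For u = -1 all terms have the factor (-1)^n. *)
    have s0 : (-1) ^+ n != 0 :> R by rewrite signr_eq0.
    apply: (mulfI s0); rewrite mulr0 -[RHS]E2 /degree_2p_part !expr1n.
    by case: n => [|m]; rewrite /= !exprS ?mulr0n; ring.
  have n1 : n.+1%:R != 0 :> R by rewrite pnatr_eq0.
  split; last first.
    have := congr2 (fun x y => x - y) E1 E2.
    by rewrite -[n.+2%:R]natr1 -[n.+1%:R]natr1; move: n%:R => m; lra.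
  apply: (mulfI n1); rewrite mulr0.
  by move: E1 E2; move: n.+2%:R n.+1%:R n%:R => m2 m1 m; lra.
have [e1 e2] := top _ _ _ _ _ _ _ H1; have [e3 e4] := top _ _ _ _ _ _ _ H2.
have n0 : 0 <= n%:R :> R by rewrite ler0n.
have n1 : n.+1%:R != 0 :> R by rewrite pnatr_eq0.
have S1 : n.+1%:R = n%:R + 1 :> R by rewrite natr1.
have S2 : n.+2%:R = n%:R + 2 :> R by rewrite -natr1 S1; lra.
have bpe : be + ep = 0.
  apply: (mul0_cancel (2 * n.+1%:R ^+ 2)); first by rewrite mulf_neq0 ?expf_neq0 ?pnatr_eq0.
  by move: e2 e4; rewrite ?S1 S2; move: n%:R => m; lra.
have bme : be - ep = 0.
  apply: (mul0_cancel (4 * n%:R + 6)); first by apply: lt0r_neq0; lra.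
  by move: e2 e4; rewrite ?S1 S2; move: n%:R => m; lra.
have be0 : be = 0 by lra.
have ep0 : ep = 0 by lra.
have dea : de = al by move: e1 e3; rewrite S2; move: n%:R => m; lra.
have kE : k = - (n.+1%:R * al) by move: e1; rewrite dea S1 S2; move: n%:R => m; lra.
split=> //; subst be ep de.
have P1 u v := (flux_eqs_homogeneous H1 u v); have P2 u v := (flux_eqs_homogeneous H2 u v).
have [n_0|n_0] := posnP n.
  have Q1 u v := let: And3 _ _ h := P1 u v in h n_0.
  have Q2 u v := let: And3 _ _ h := P2 u v in h n_0.
  have C1 := (Q1 1 0).2; have D1' := (Q1 0 1).2; have D2' := (Q2 0 1).2.
  have AB := (Q1 0 0).1.
  move: C1 D1' D2' AB; rewrite /degree_p_part kE n_0 /= !expr0 !expr1 expr0n /=.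
  move=> C1 D1' D2' AB.
  have aal : a * al = 0 by lra.
  have ze0 : ze = 0 by apply: (mul0_cancel b) => //; lra.
  have ga0 : ga = 0 by apply: (mul0_cancel b) => //; lra.
  by split=> //; rewrite ga0 ze0 in AB; lra.
have Q1 u v := let: And3 _ h _ := P1 u v in h n_0.
have Q2 u v := let: And3 _ h _ := P2 u v in h n_0.
have [A _ C _] := Q1 1 0; have [_ _ _ D'] := Q1 1 1; have [_ _ _ D2'] := Q2 1 1.
have aal : a * al = 0.
  apply: (mul0_cancel (n.+2%:R * n.+1%:R)); first by rewrite mulf_neq0 ?pnatr_eq0.
  apply/eqP; rewrite -oppr_eq0; apply/eqP.
  rewrite -[RHS]C /degree_p_part kE !expr1n !exprS !expr0n (gtn_eqF n_0) /=.
  by ring.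
move: D' D2'; rewrite !expr1n => /(mul0_cancel _ _ b0) D' /(mul0_cancel _ _ b0) D2'.
have {}D' : n%:R * ga + n.+2%:R * ze = 0.
  by apply: (mul0_cancel n.+1%:R) => //; rewrite -[RHS]D'; ring.
have {}D2' : n%:R * ze + n.+2%:R * ga = 0.
  by apply: (mul0_cancel n.+1%:R) => //; rewrite -[RHS]D2'; ring.
have gpz : ga + ze = 0.
  by apply: (mul0_cancel n.+1%:R) => //; move: D' D2'; rewrite ?S1 S2; move: n%:R => m; lra.
have gmz : ga - ze = 0 by move: D' D2'; rewrite S2; move: n%:R => m; lra.
by split=> //; lra.
Qed.

Lemma sols_b_flux_eqs al be ga ep de ze k chi :
  sols_b al be ga ep de ze k chi -> flux_eqs k chi al be ga ep de ze.
Proof.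
move=> [[-> -> -> ->] [aal -> -> ->]] u v /=.
have {}aal (x : R) : a * al * x = 0 by rewrite aal mul0r.
split.
- apply: etrans (aal (- n.+1%:R * (n.+2%:R * u ^+ n.+1 + v ^+ n.+1)
    + n.+2%:R * n.+1%:R * u ^+ n.+1 - n.+1%:R * (n.+2%:R * u ^+ n.+1 + v ^+ n.+1)
    + n.+1%:R * v ^+ n.+1)).
  rewrite /phi1 /phi2 /phi11 /phi12.
  case: n => [|m]; rewrite ?mulr0n /= !exprS; first by ring.
  by rewrite -?[m.+3%:R]natr1 -?[m.+2%:R]natr1 -?[m.+1%:R]natr1; ring.
- apply: etrans (aal (- 2 * n.+1%:R * n.+1%:R * u * v ^+ n
    + u * n.+1%:R * v ^+ n + n.+1%:R * n%:R * u * v ^+ n)).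
  rewrite /phi2 /phi12 /phi22.
  case: n => [|m]; rewrite ?mulr0n /= !exprS; first by ring.
  by rewrite -?[m.+3%:R]natr1 -?[m.+2%:R]natr1 -?[m.+1%:R]natr1; ring.
Qed.

(** For p = 1 the flux is (u + v) u, and for p = 2 it is (u^2 + v^2) u: the
extra symmetries come from the matrices preserving u + v up to scaling, and
from the rotations. *)
Definition sols_a al be ga ep de ze k chi :=
  [/\ ga = 0, ze = 0 & chi = 0] /\
  match n with
  | 0 => 2 * k + al + ep = 0 /\ 2 * k + be + de = 0
  | 1 => [/\ be + ep = 0, k + al = 0 & k + de = 0]
  | _ => [/\ be = 0, ep = 0, de = al & 2 * k + n.+1%:R * al = 0]
  end.

(** For b = 0 the flux is homogeneous of degree p + 1, and few evaluations of
the parts of degree p and p - 1 suffice. For p > 1 the off-diagonal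
coefficients satisfy p be + 2 ep = 0 = p ep + 2 be, a system which is
degenerate precisely for p = 2. *)
Lemma flux_eqs_a k chi al be ga ep de ze : b = 0 -> a != 0 ->
  flux_eqs k chi al be ga ep de ze -> flux_eqs k chi de ep ze be al ga ->
  sols_a al be ga ep de ze k chi.
Proof.
move=> b0 a0 H1 H2.
have P1 u v := (flux_eqs_homogeneous H1 u v); have P2 u v := (flux_eqs_homogeneous H2 u v).
have n1 : n.+1%:R != 0 :> R by rewrite pnatr_eq0.
have n2 : n.+2%:R != 0 :> R by rewrite pnatr_eq0.
have [n_0|n_0] := posnP n.
  have Q1 u v := let: And3 _ _ h := P1 u v in h n_0.
  have C1 := (Q1 1 0).2; have C2 := (Q1 0 1).2; have AB := (Q1 0 0).1.
  have G1 := (H1 0 0).2; have G2 := (H2 0 0).2.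
  move: C1 C2 AB G1 G2.
  rewrite /degree_p_part /phi1 /phi2 /phi12 /phi22 b0 n_0 /= !expr0 !expr1 expr0n /=.
  move=> C1 C2 AB G1 G2.
  have ga0 : ga = 0 by apply: (mul0_cancel a) => //; lra.
  have ze0 : ze = 0 by apply: (mul0_cancel a) => //; lra.
  rewrite /sols_a n_0; split; first by split=> //; rewrite ga0 ze0 in AB; lra.
  by split; apply: (mul0_cancel a) => //; lra.
have Q1 u v := let: And3 _ h _ := P1 u v in h n_0.
have Q2 u v := let: And3 _ h _ := P2 u v in h n_0.
have [A B C _] := Q1 1 0; have [_ _ C' _] := Q1 1 1.
have [_ B2 C2 _] := Q2 1 0; have [_ _ C2' _] := Q2 1 1.
have n0 : 1 <= n%:R :> R by rewrite ler1n.
have S1 : n.+1%:R = n%:R + 1 :> R by rewrite natr1.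
have S2 : n.+2%:R = n%:R + 2 :> R by rewrite -natr1 S1; lra.
move: C C' C2 C2' => /(mul0_cancel _ _ a0) + /(mul0_cancel _ _ a0) +.
move=> + + /(mul0_cancel _ _ a0) + /(mul0_cancel _ _ a0).
rewrite /degree_p_part !expr1n !exprS !expr0n (gtn_eqF n_0) /= => C C' C2 C2'.
have {}C : 2 * k + n.+1%:R * al = 0.
  by apply: (mul0_cancel n.+2%:R) => //; rewrite -[RHS]C; ring.
have {}C2 : 2 * k + n.+1%:R * de = 0.
  by apply: (mul0_cancel n.+2%:R) => //; rewrite -[RHS]C2; ring.
have C3 := congr1 (fun x => n.+2%:R * x) C.
have C4 := congr1 (fun x => n.+2%:R * x) C2.
have {}C' : n.+1%:R * be + 2 * ep = 0.
  apply: (mul0_cancel n.+1%:R) => //.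
  by move: C C2 C' C3; rewrite S1 S2; move: n%:R => m; lra.
have {}C2' : n.+1%:R * ep + 2 * be = 0.
  apply: (mul0_cancel n.+1%:R) => //.
  by move: C C2 C2' C4; rewrite S1 S2; move: n%:R => m; lra.
have ga0 : ga = 0.
  apply: (mul0_cancel (a * (n.+2%:R * n.+1%:R))); first by rewrite !mulf_neq0.
  by rewrite -[RHS]B expr1n expr0n (gtn_eqF n_0) /=; ring.
have ze0 : ze = 0.
  apply: (mul0_cancel (a * (n.+2%:R * n.+1%:R))); first by rewrite !mulf_neq0.
  by rewrite -[RHS]B2 expr1n expr0n (gtn_eqF n_0) /=; ring.
split; first by split=> //; lra.
have bpe : be + ep = 0.
  apply: (mul0_cancel (n%:R + 3)); first by apply: lt0r_neq0; lra.
  by move: C' C2'; rewrite S1; move: n%:R => m; lra.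
case: n n_0 C C2 C' C2' n0 => [|[|m]] // _; first by move=> *; split=> //; lra.
move=> C C2 C' C2' _.
have m0 : 0 <= m%:R :> R by rewrite ler0n.
have S3 : m.+3%:R = m%:R + 3 :> R by rewrite -!natr1; lra.
have be0 : be = 0.
  apply: (mul0_cancel (m%:R + 1)); first by apply: lt0r_neq0; lra.
  move: C'; rewrite S3 => C'.
  have -> : (m%:R + 1) * be = (m%:R + 3) * be + 2 * ep - 2 * (be + ep) by ring.
  by rewrite C' bpe mulr0 subr0.
split=> //; first lra.
apply/eqP; rewrite -subr_eq0; apply/eqP.
apply: (mul0_cancel m.+3%:R); first by rewrite pnatr_eq0.
by rewrite mulrBr; lra.
Qed.

Lemma sols_a_flux_eqs al be ga ep de ze k chi : b = 0 ->
  sols_a al be ga ep de ze k chi -> flux_eqs k chi al be ga ep de ze.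
Proof.
move=> b0 [[-> -> ->]] H u v /=.
rewrite /phi1 /phi2 /phi11 /phi12 /phi22 b0 !mul0r !addr0 subr0.
case: n H => [|[|m]].
- move=> [E1 E2]; rewrite /= !expr0 !expr1 !mulr1; split.
    apply: etrans (_ : a * (2 * u * (2 * k + al + ep) + v * (2 * k + be + de)) = 0); first by ring.
    by rewrite E1 E2 !mulr0 addr0 mulr0.
  apply: etrans (_ : a * (u * (2 * k + be + de)) = 0); first by ring.
  by rewrite E2 !mulr0.
- move=> [E1 E2 E3].
  have -> : ep = - be by lra.
  have -> : al = - k by lra.
  have -> : de = - k by lra.
  by rewrite /= !exprS; split; ring.
- move=> [-> -> -> E].
  split.
    apply: etrans (_ : a * (m.+4%:R * u ^+ m.+3 + v ^+ m.+3) * (2 * k + m.+3%:R * al) = 0).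
      by rewrite /= !exprS; ring.
    by rewrite E mulr0.
  apply: etrans (_ : a * m.+3%:R * u * v ^+ m.+2 * (2 * k + m.+3%:R * al) = 0).
    by rewrite /= -![m.+3%:R]natr1 -![m.+2%:R]natr1 !exprS; ring.
  by rewrite E mulr0.
Qed.

Lemma sols_aC al be ga ep de ze k chi :
  sols_a al be ga ep de ze k chi -> sols_a de ep ze be al ga k chi.
Proof.
rewrite /sols_a => -[[-> -> ->]] H; split=> //.
case: n H => [|[|m]].
- by move=> [? ?]; split; lra.
- by move=> [? ? ?]; split; lra.
- by move=> [-> -> -> ?].
Qed.

End Flux.
End FluxAlgebra.

(** * Functions with constant gradient *)

Section ConstantGradient.
Variable R : realType.
Implicit Types (h : (bvar -> R) -> R) (q : bvar -> R).
Local Notation upd := (@dfwith _ (fun=> R)).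

Lemma pderiv0_upd_uv h q u v : smooth h ->
  pderiv Bu h = (fun=> 0) -> pderiv Bv h = (fun=> 0) ->
  h (upd (upd q Bu u) Bv v) = h q.
Proof.
move=> sh hu hv.
rewrite (pderiv0_upd (fun q => smooth_pderivable sh) hv).
exact: (pderiv0_upd (fun q => smooth_pderivable sh) hu).
Qed.

Lemma affine_uv h q u v : smooth h ->
  (forall z w, z \in [:: Bu; Bv] -> w \in [:: Bu; Bv] ->
     pderiv w (pderiv z h) = (fun=> 0)) ->
  h (upd (upd q Bu u) Bv v) =
  pderiv Bu h q * u + pderiv Bv h q * v + h (upd (upd q Bu 0) Bv 0).
Proof.
move=> sh h2.
have sz z := smooth_pderiv z sh.
have dh q' z : pderivable z h q' := smooth_pderivable sh.
have Kv q' s : pderiv Bv h (upd q' Bv s) = pderiv Bv h q'.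
  exact: (pderiv0_upd (fun q => smooth_pderivable (sz Bv)) (h2 Bv Bv isT isT)).
have Ku q' s : pderiv Bu h (upd q' Bu s) = pderiv Bu h q'.
  exact: (pderiv0_upd (fun q => smooth_pderivable (sz Bu)) (h2 Bu Bu isT isT)).
have Kvu q' s : pderiv Bu h (upd q' Bv s) = pderiv Bu h q'.
  exact: (pderiv0_upd (fun q => smooth_pderivable (sz Bu)) (h2 Bu Bv isT isT)).
have Kuv q' s : pderiv Bv h (upd q' Bu s) = pderiv Bv h q'.
  exact: (pderiv0_upd (fun q => smooth_pderivable (sz Bv)) (h2 Bv Bu isT isT)).
rewrite (@pderiv_line _ _ Bv h _ _ (fun q => dh q Bv) (Kv (upd q Bu u)) 0 v).
rewrite updC // (@pderiv_line _ _ Bu h _ _ (fun q => dh q Bu) (Ku (upd q Bv 0)) 0 u).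
by rewrite Kvu Kuv (@updC _ _ q Bv Bu 0 0) // !subr0; lra.
Qed.

Lemma gradient_cst_affine h (d : bvar -> R) q : smooth h ->
  (forall z, pderiv z h = (fun=> d z)) ->
  h q = d Bt * q Bt + d Bx * q Bx + d Bu * q Bu + d Bv * q Bv + h (fun=> 0).
Proof.
move=> sh hd.
have step q' z : h q' = h (upd q' z 0) + d z * q' z.
  have := @pderiv_line _ _ z h q' (d z) (fun=> smooth_pderivable sh) _ 0 (q' z).
  by rewrite (upd_id q' z) subr0; apply; rewrite hd.
rewrite (step q Bt) (step (upd q Bt 0) Bx) (step (upd (upd q Bt 0) Bx 0) Bu).
rewrite (step (upd (upd (upd q Bt 0) Bx 0) Bu 0) Bv).
rewrite [upd (upd (upd (upd q Bt 0) Bx 0) Bu 0) Bv 0](_ : _ = fun=> 0).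
  by rewrite !dfwithout //; lra.
by apply/funext; case; do 4? [rewrite dfwithin // | rewrite dfwithout //].
Qed.

Lemma D_affine h (d : bvar -> R) : (forall z, pderiv z h = (fun=> d z)) ->
  [/\ forall J, Dt1 h J = d Bt + J (Ju 1 0)%N * d Bu + J (Jv 1 0)%N * d Bv,
      forall J, D1 h J = d Bx + J (Ju 0 1)%N * d Bu + J (Jv 0 1)%N * d Bv,
      forall J, D2 h J = J (Ju 0 2)%N * d Bu + J (Jv 0 2)%N * d Bv
    & forall J, D3 h J = J (Ju 0 3)%N * d Bu + J (Jv 0 3)%N * d Bv].
Proof.
move=> hd; have c0 (z : bvar) k : pderiv z (fun _ : bvar -> R => k) = (fun=> 0 : R).
  exact: pderiv_cst0.
split=> J.
- by rewrite /Dt1 !hd.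
- by rewrite /D1 !hd.
- by rewrite /D2 /D1 !hd !c0; ring.
- by rewrite /D3 /D2 /D1 !hd !c0; ring.
Qed.

End ConstantGradient.

(** * The system as a pair of third-order equations *)

Section KdvSystem.
Variables (R : realType) (a b c : R) (n : nat).
Implicit Types (q : bvar -> R) (J : jet R) (Y : vfield R).
Local Notation upd := (@dfwith _ (fun=> R)).

Definition flux_u (z w : bvar) q := phi1 a b n (q z) (q w).
Definition flux_v (z w : bvar) q := phi2 a b n (q z) (q w).

Lemma is_pderiv_flux_u y z w : is_pderiv y (flux_u z w) (fun q =>
  (y == z)%:R * phi11 a b n (q z) (q w) + (y == w)%:R * phi12 a b n (q z) (q w)).
Proof.
have cz := @is_pderiv_coord R _ y z; have cw := @is_pderiv_coord R _ y w.
have C k := @is_pderiv_cst R bvar y k.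
have H := is_pderivD
 (is_pderivM (C a) (is_pderivD (is_pderivM (C n.+2%:R) (is_pderivX n.+1 cz)) (is_pderivX n.+1 cw)))
 (is_pderivM (C b) (is_pderivM (is_pderivM (C n.+1%:R) (is_pderivX n cz)) (is_pderivX n.+2 cw))).
by apply: (is_pderiv_ext _ H) => q /=; rewrite /phi11 /phi12 /=; ring.
Qed.

Lemma is_pderiv_flux_v y z w : is_pderiv y (flux_v z w) (fun q =>
  (y == z)%:R * phi12 a b n (q z) (q w) + (y == w)%:R * phi22 a b n (q z) (q w)).
Proof.
have cz := @is_pderiv_coord R _ y z; have cw := @is_pderiv_coord R _ y w.
have C k := @is_pderiv_cst R bvar y k.
have H := is_pderivD
 (is_pderivM (C a) (is_pderivM (is_pderivM (C n.+1%:R) cz) (is_pderivX n cw)))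
 (is_pderivM (C b) (is_pderivM (is_pderivM (C n.+2%:R) (is_pderivX n.+1 cz)) (is_pderivX n.+1 cw))).
by apply: (is_pderiv_ext _ H) => q /=; rewrite /phi22 /phi12 /=; ring.
Qed.

Lemma smooth_flux_u z w : smooth (flux_u z w).
Proof.
by rewrite /flux_u /phi1; smooth_poly.
Qed.

Lemma smooth_flux_v z w : smooth (flux_v z w).
Proof.
by rewrite /flux_v /phi2; smooth_poly.
Qed.

Lemma lie_flux_u Y z w q : (z, w) \in [:: (Bu, Bv); (Bv, Bu)] ->
  lie Y (flux_u z w) q =
  Y z q * phi11 a b n (q z) (q w) + Y w q * phi12 a b n (q z) (q w).
Proof.
move=> zw; rewrite /lie !(pderivE (is_pderiv_flux_u _ _ _)).
by move: zw; rewrite !inE => /orP[] /eqP[-> ->] /=; ring.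
Qed.

Lemma lie_flux_v Y z w q : (z, w) \in [:: (Bu, Bv); (Bv, Bu)] ->
  lie Y (flux_v z w) q =
  Y z q * phi12 a b n (q z) (q w) + Y w q * phi22 a b n (q z) (q w).
Proof.
move=> zw; rewrite /lie !(pderivE (is_pderiv_flux_v _ _ _)).
by move: zw; rewrite !inE => /orP[] /eqP[-> ->] /=; ring.
Qed.

(** In the term with factor b the dependent variable is the other one, hence
the index [~~ e]. *)
Lemma Dx_flux e J :
  a * Dx (fun J => (J (Ju 0 0) ^+ n.+1 + J (Jv 0 0) ^+ n.+1) * J (jw e 0 0)) J
  + b * Dx (fun J => (J (Ju 0 0) * J (Jv 0 0)) ^+ n.+1 * J (jw (~~ e) 0 0)) J
  = J (Ju 0 1) * (if e then flux_v Bv Bu else flux_u Bu Bv) (jbase J)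
    + J (Jv 0 1) * (if e then flux_u Bv Bu else flux_v Bu Bv) (jbase J).
Proof.
pose fa q := (q Bu ^+ n.+1 + q Bv ^+ n.+1) * q (dep e) : R.
pose fb q := (q Bu * q Bv) ^+ n.+1 * q (dep (~~ e)) : R.
have sfa : smooth fa by rewrite /fa; smooth_poly.
have sfb : smooth fb by rewrite /fb; smooth_poly.
have C y z := @is_pderiv_coord R bvar y z.
have dfa y := is_pderivM (is_pderivD (is_pderivX n.+1 (C y Bu))
  (is_pderivX n.+1 (C y Bv))) (C y (dep e)).
have dfb y := is_pderivM (is_pderivX n.+1 (is_pderivM (C y Bu) (C y Bv)))
  (C y (dep (~~ e))).
have -> : (fun J => (J (Ju 0 0) ^+ n.+1 + J (Jv 0 0) ^+ n.+1) * J (jw e 0 0))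
    = (fun J : jet R => fa (jbase J))%N by rewrite /fa; case: (e).
have -> : (fun J => (J (Ju 0 0) * J (Jv 0 0)) ^+ n.+1 * J (jw (~~ e) 0 0))
    = (fun J : jet R => fb (jbase J))%N by rewrite /fb; case: (e).
rewrite (DxP (is_tderiv_D1 sfa)) (DxP (is_tderiv_D1 sfb)) /D1.
rewrite !(pderivE (dfa _)) !(pderivE (dfb _)).
case: e {fa fb sfa sfb dfa dfb}; rewrite /flux_u /flux_v /phi1 /phi2 /=.
  by rewrite !exprMn !exprS -?[n.+2%:R]natr1; ring.
by rewrite !exprMn !exprS -?[n.+2%:R]natr1; ring.
Qed.

Lemma F1_kdv : F1 a b c n.+1 = kdv_lhs false (flux_u Bu Bv) (flux_v Bu Bv) c.
Proof. by apply/funext => J; rewrite /kdv_lhs -(Dx_flux false J) /F1 !addrA. Qed.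

Lemma F2_kdv : F2 a b c n.+1 = kdv_lhs true (flux_v Bv Bu) (flux_u Bv Bu) c.
Proof. by apply/funext => J; rewrite /kdv_lhs -(Dx_flux true J) /F2 !addrA. Qed.
End KdvSystem.

(** * Classification of the generators *)

Section Classification.
Variables (R : realType) (a b c : R) (n : nat).
Hypothesis c0 : c != 0.
Implicit Types (q : bvar -> R) (J : jet R) (Y : vfield R).
Local Notation upd := (@dfwith _ (fun=> R)).

Definition affine_field (k t0 x0 al be ep de : R) : vfield R :=
  vf (fun q => 3 * k * q Bt + t0) (fun q => k * q Bx + x0)
     (fun q => al * q Bu + be * q Bv) (fun q => ep * q Bu + de * q Bv).

Local Notation f1 := (flux_u a b n Bu Bv).
Local Notation f2 := (flux_v a b n Bu Bv).
Local Notation g1 := (flux_v a b n Bv Bu).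
Local Notation g2 := (flux_u a b n Bv Bu).
Local Notation sf1 := (@smooth_flux_u R a b n Bu Bv).
Local Notation sf2 := (@smooth_flux_v R a b n Bu Bv).
Local Notation sg1 := (@smooth_flux_v R a b n Bv Bu).
Local Notation sg2 := (@smooth_flux_u R a b n Bv Bu).

Lemma affine_field_generator k t0 x0 al be ep de :
  flux_eqs a b n k 0 al be 0 ep de 0 -> flux_eqs a b n k 0 de ep 0 be al 0 ->
  lie_generator (F1 a b c n.+1) (F2 a b c n.+1) (affine_field k t0 x0 al be ep de).
Proof.
move=> H1 H2; set Y := affine_field _ _ _ _ _ _ _.
have sY z : smooth (Y z) by case: z; rewrite /Y /=; smooth_poly.
have C y z := @is_pderiv_coord R bvar y z.
have K y k' := @is_pderiv_cst R bvar y k'.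
have dT z : pderiv z (Y Bt) = fun=> 3 * k * (z == Bt)%:R.
  rewrite (pderivE (is_pderivD (is_pderivM (K z (3 * k)) (C z Bt)) (K z t0))).
  by apply/funext => q; ring.
have dX z : pderiv z (Y Bx) = fun=> k * (z == Bx)%:R.
  rewrite (pderivE (is_pderivD (is_pderivM (K z k) (C z Bx)) (K z x0))).
  by apply/funext => q; ring.
have dU z : pderiv z (Y Bu) = fun=> al * (z == Bu)%:R + be * (z == Bv)%:R.
  rewrite (pderivE (is_pderivD (is_pderivM (K z al) (C z Bu)) (is_pderivM (K z be) (C z Bv)))).
  by apply/funext => q; ring.
have dV z : pderiv z (Y Bv) = fun=> ep * (z == Bu)%:R + de * (z == Bv)%:R.
  rewrite (pderivE (is_pderivD (is_pderivM (K z ep) (C z Bu)) (is_pderivM (K z de) (C z Bv)))).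
  by apply/funext => q; ring.
have [Tt T1 T2 T3] := D_affine dT; have [Xt X1 X2 X3] := D_affine dX.
have [Ut U1 U2 U3] := D_affine dU; have [Vt V1 V2 V3] := D_affine dV.
have kst k' : diff_fun (fun _ : jet R => k').
  by split; [apply: smooth_cst|exists 0%N].
split=> //; exists (fun=> al - 3 * k), (fun=> be), (fun=> ep), (fun=> de - 3 * k).
split; first by split; apply: kst.
move=> J; rewrite F1_kdv F2_kdv.
have E1 := pr3_kdv_explicit c sY sf1 sf2 sg1 sg2 false J.
have E2 := pr3_kdv_explicit c sY sf1 sf2 sg1 sg2 true J.
rewrite /coef_u /coef_v /dep /= in E1 E2; rewrite E1 E2 {E1 E2} !lie_flux_u // !lie_flux_v //.
rewrite Tt Xt Ut Vt !T1 !X1 !T2 !X2 !T3 !X3 !U1 !V1 !U3 !V3.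
rewrite /kdv_lhs /flux_u /flux_v /jw /=.
have [h1 h2] := H1 (J (Ju 0 0)) (J (Jv 0 0)).
have [h3 h4] := H2 (J (Jv 0 0)) (J (Ju 0 0)).
move: h1 h2 h3 h4; rewrite !(addr0, subr0).
move: (phi1 a b n _ _) (phi1 a b n _ _) (phi2 a b n _ _) (phi2 a b n _ _).
move: (phi11 a b n _ _) (phi11 a b n _ _) (phi12 a b n _ _) (phi12 a b n _ _).
move: (phi22 a b n _ _) (phi22 a b n _ _).
move: (J (Ju 0 0)) (J (Ju 0 1)) (J (Ju 0 2)) (J (Ju 0 3)) (J (Ju 1 0)) (J (Ju 1 1)) (J (Ju 1 2)).
move: (J (Jv 0 0)) (J (Jv 0 1)) (J (Jv 0 2)) (J (Jv 0 3)) (J (Jv 1 0)) (J (Jv 1 1)) (J (Jv 1 2)).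
move=> v v1 v2 v3 vt vtx vtxx u u1 u2 u3 ut utx utxx.
move=> A B p11 p11' p12 p12' p2 p2' p1 p1' h1 h2 h3 h4.
split; apply/eqP; rewrite -subr_eq0; apply/eqP.
- apply: etrans (_ : u1 * 0 + v1 * 0 = 0); last by rewrite !mulr0 addr0.
  by rewrite -{1}h1 -{1}h2; ring.
- apply: etrans (_ : v1 * 0 + u1 * 0 = 0); last by rewrite !mulr0 addr0.
  by rewrite -{1}h3 -{1}h4; ring.
Qed.

(** The hypothesis isolates what is used of the algebra of the fluxes: the
determining equations at a point leave no room for constant parts of U and V,
nor for X_t. *)
Lemma generator_affine Y :
  (forall k chi al be ga ep de ze,
     flux_eqs a b n k chi al be ga ep de ze ->
     flux_eqs a b n k chi de ep ze be al ga -> [/\ ga = 0, ze = 0 & chi = 0]) ->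
  lie_generator (F1 a b c n.+1) (F2 a b c n.+1) Y ->
  exists k t0 x0 al be ep de,
    [/\ Y = affine_field k t0 x0 al be ep de,
        flux_eqs a b n k 0 al be 0 ep de 0 & flux_eqs a b n k 0 de ep 0 be al 0].
Proof.
move=> rigid [sY [M [N [P [Q [_ HY]]]]]].
have inv : invariant Y f1 f2 g1 g2 c.
  move=> J J0 e; have [E1 E2] := HY J; move: E1 E2.
  rewrite F1_kdv F2_kdv (J0 false : kdv_lhs false f1 f2 c J = 0).
  rewrite (J0 true : kdv_lhs true g1 g2 c J = 0) !mulr0 addr0.
  by case: e.
have T0 := @sym_T_of_t _ _ _ _ _ _ _ sY sf1 sf2 sg1 sg2 c0 inv.
have X0 := @sym_X_of_tx _ _ _ _ _ _ _ sY sf1 sf2 sg1 sg2 c0 inv.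
have Tt := @sym_Tt_Xx _ _ _ _ _ _ _ sY sf1 sf2 sg1 sg2 c0 inv.
have Xxx := @sym_Xxx _ _ _ _ _ _ _ sY sf1 sf2 sg1 sg2 c0 inv.
have UV := @sym_UV_affine _ _ _ _ _ _ _ sY sf1 sf2 sg1 sg2 c0 inv.
have FL := @sym_first_order _ _ _ _ _ _ _ sY sf1 sf2 sg1 sg2 c0 inv.
have nul z w h : smooth h -> pderiv z h = (fun=> 0) ->
    pderiv z (pderiv w h) = (fun=> 0).
  by move=> sh; apply: pderiv0_pderiv => q; apply: smooth_pderivable.
pose Z q := upd (upd q Bu 0) Bv 0.
have halves q : flux_eqs a b n (pderiv Bx (Y Bx) q) (pderiv Bt (Y Bx) q)
      (pderiv Bu (Y Bu) q) (pderiv Bv (Y Bu) q) (Y Bu (Z q))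
      (pderiv Bu (Y Bv) q) (pderiv Bv (Y Bv) q) (Y Bv (Z q)) /\
    flux_eqs a b n (pderiv Bx (Y Bx) q) (pderiv Bt (Y Bx) q)
      (pderiv Bv (Y Bv) q) (pderiv Bu (Y Bv) q) (Y Bv (Z q))
      (pderiv Bv (Y Bu) q) (pderiv Bu (Y Bu) q) (Y Bu (Z q)).
  (* At fixed (t, x) the coefficients do not change when (u, v) varies. *)
  have main u v : let q' := upd (upd q Bu u) Bv v in
      [/\ q' Bu = u, q' Bv = v,
          pderiv Bx (Y Bx) q' = pderiv Bx (Y Bx) q
        & pderiv Bt (Y Bx) q' = pderiv Bt (Y Bx) q] /\
      forall e, [/\ Y (dep e) q' = pderiv Bu (Y (dep e)) q * u
                     + pderiv Bv (Y (dep e)) q * v + Y (dep e) (Z q),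
                    pderiv Bu (Y (dep e)) q' = pderiv Bu (Y (dep e)) q
                  & pderiv Bv (Y (dep e)) q' = pderiv Bv (Y (dep e)) q].
    split.
      split; [by rewrite dfwithout // dfwithin|by rewrite dfwithin| |].
        by apply: pderiv0_upd_uv; [apply: smooth_pderiv
          |apply: nul (X0 Bu isT)|apply: nul (X0 Bv isT)].
      by apply: pderiv0_upd_uv; [apply: smooth_pderiv
        |apply: nul (X0 Bu isT)|apply: nul (X0 Bv isT)].
    move=> e; split.
    - apply: affine_uv; first exact: sY.
      move=> z w zuv wuv; apply: (UV e _ _ zuv _).1.
      by move: wuv; rewrite !inE => /orP[] ->; rewrite ?orbT.
    - by apply: pderiv0_upd_uv; [apply: smooth_pderiv
        |apply: (UV e Bu Bu isT isT).1|apply: (UV e Bu Bv isT isT).1].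
    - by apply: pderiv0_upd_uv; [apply: smooth_pderiv
        |apply: (UV e Bv Bu isT isT).1|apply: (UV e Bv Bv isT isT).1].
  split=> u v.
  - have [[qu qv qk qc] W] := main u v.
    have [Uq Uu Uv] := W false; have [Vq Vu Vv] := W true.
    have E u1 v1 := FL false (upd (upd q Bu u) Bv v) u1 v1.
    move: E; rewrite /coef_u /coef_v /dep /= /dep /= in W Uq Uu Uv Vq Vu Vv *.
    rewrite !lie_flux_u // !lie_flux_v // /flux_u /flux_v Uq Vq Uu Uv Vu Vv qu qv qk qc.
    move=> E; have := E 0 0; have := E 1 0; have := E 0 1.
    move: (phi1 a b n _ _) (phi1 a b n _ _) (phi2 a b n _ _) (phi2 a b n _ _).
    move: (phi11 a b n _ _) (phi12 a b n _ _) (phi22 a b n _ _).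
    move: (Y Bu (Z q)) (Y Bv (Z q)); name_values; clear.
    by intros; split; lra.
  - have [[qu qv qk qc] W] := main v u.
    have [Uq Uu Uv] := W false; have [Vq Vu Vv] := W true.
    have E u1 v1 := FL true (upd (upd q Bu v) Bv u) u1 v1.
    move: E; rewrite /coef_u /coef_v /dep /= /dep /= in W Uq Uu Uv Vq Vu Vv *.
    rewrite !lie_flux_u // !lie_flux_v // /flux_u /flux_v Uq Vq Uu Uv Vu Vv qu qv qk qc.
    move=> E; have := E 0 0; have := E 1 0; have := E 0 1.
    move: (phi1 a b n _ _) (phi1 a b n _ _) (phi2 a b n _ _) (phi2 a b n _ _).
    move: (phi11 a b n _ _) (phi12 a b n _ _) (phi22 a b n _ _).
    move: (Y Bu (Z q)) (Y Bv (Z q)); name_values; clear.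
    by intros; split; lra.
(* Thus U and V are linear in (u, v). *)
have zero q : [/\ Y Bu (Z q) = 0, Y Bv (Z q) = 0 & pderiv Bt (Y Bx) q = 0].
  by have [H1 H2] := halves q; apply: rigid H1 H2.
have Xt : pderiv Bt (Y Bx) = (fun=> 0) by apply/funext => q; have [] := zero q.
have Wx e : pderiv Bx (Y (dep e)) = (fun=> 0).
  have sW := sY (dep e).
  apply/funext => q.
  rewrite -(@pderiv0_upd_uv _ _ q 0 0 (smooth_pderiv Bx sW)
     (UV e Bu Bx isT isT).2 (UV e Bv Bx isT isT).2).
  rewrite /pderiv (_ : (fun s => _) = fun=> 0) ?derive1_cst //.
  apply/funext => s; rewrite updC // (@updC _ _ q Bu Bx) //.
  by have [] := zero (upd q Bx s); case: (e).
have Wt e : pderiv Bt (Y (dep e)) = (fun=> 0).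
  apply/funext => q; have := FL e q 0 0; rewrite /=.
  rewrite (Wx false : pderiv Bx (Y Bu) = _) (Wx true : pderiv Bx (Y Bv) = _) Wx.
  rewrite !pderiv_cst0 if_same; move: (coef_u _ _ _ _) (coef_v _ _ _ _) (f1 q) (f2 q) (g1 q) (g2 q).
  by name_values; intros; lra.
pose o : bvar -> R := fun=> 0.
have cst h : smooth h -> (forall z, pderiv z h = (fun=> 0)) -> h = fun=> h o.
  move=> sh h0; apply/funext => q.
  by rewrite (@gradient_cst_affine _ h (fun=> 0) q sh h0) !mul0r !add0r.
have kE : pderiv Bx (Y Bx) = fun=> pderiv Bx (Y Bx) o.
  apply: cst => [|z]; first exact: smooth_pderiv.
  case: z; [exact: nul Xt|exact: Xxx|exact: nul (X0 Bu isT)|exact: nul (X0 Bv isT)].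
have WE e z : z \in [:: Bu; Bv] ->
    pderiv z (Y (dep e)) = fun=> pderiv z (Y (dep e)) o.
  move=> zuv; apply: cst => [|w]; first exact: smooth_pderiv.
  case: w; [exact: nul (Wt e)|exact: (UV e z Bx zuv isT).1
    |exact: (UV e z Bu zuv isT).1|exact: (UV e z Bv zuv isT).1].
have Zo : Z o = o.
  by apply/funext; case; rewrite /Z; do 2? [rewrite dfwithin // | rewrite dfwithout //].
have [Uo Vo _] := zero o; rewrite Zo in Uo Vo.
exists (pderiv Bx (Y Bx) o), (Y Bt o), (Y Bx o), (pderiv Bu (Y Bu) o),
  (pderiv Bv (Y Bu) o), (pderiv Bu (Y Bv) o), (pderiv Bv (Y Bv) o).
have [H1 H2] := halves o; rewrite Zo Uo Vo Xt in H1 H2; split=> //.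
apply/funext => z; apply/funext => q; case: z => /=.
- rewrite (@gradient_cst_affine _ _
    (fun z => if z is Bt then 3 * pderiv Bx (Y Bx) o else 0) q (sY Bt)).
    by rewrite !mul0r !addr0.
  case; [by apply/funext => q'; rewrite Tt kE|exact: T0..].
- rewrite (@gradient_cst_affine _ _
    (fun z => if z is Bx then pderiv Bx (Y Bx) o else 0) q (sY Bx)).
    by rewrite !mul0r !addr0 add0r.
  by case; [exact: Xt|exact: kE|exact: X0|exact: X0].
- rewrite (@gradient_cst_affine _ _ (fun z => if z is Bu then pderiv Bu (Y Bu) o
    else if z is Bv then pderiv Bv (Y Bu) o else 0) q (sY Bu)).
    by rewrite -/o Uo !mul0r addr0 !add0r.
  by case; [exact: (Wt false)|exact: (Wx false)|exact: (WE false)|exact: (WE false)].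
- rewrite (@gradient_cst_affine _ _ (fun z => if z is Bu then pderiv Bu (Y Bv) o
    else if z is Bv then pderiv Bv (Y Bv) o else 0) q (sY Bv)).
    by rewrite -/o Vo !mul0r addr0 !add0r.
  by case; [exact: (Wt true)|exact: (Wx true)|exact: (WE true)|exact: (WE true)].
Qed.

End Classification.

(** * Linear spans and the three cases *)

Section Span.
Variable R : realType.
Implicit Types (s : seq (vfield R)) (X Y : vfield R).

Lemma vfieldD X Y z q : (X + Y) z q = X z q + Y z q. Proof. by []. Qed.
Lemma vfieldZ (k : R) X z q : (k *: X) z q = k * X z q. Proof. by []. Qed.

Lemma vspan_nil Y : vspan [::] Y <-> Y = 0.
Proof.
split=> [[k ->]|->]; first by rewrite big_ord0.
by exists (fun=> 0); rewrite big_ord0.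
Qed.

Lemma vspan_cons X s Y :
  vspan (X :: s) Y <-> exists k, vspan s (Y - k *: X).
Proof.
split=> [[k ->]|[k [l E]]].
  by exists (k ord0), (fun i => k (lift ord0 i)); rewrite big_ord_recl addrC addKr.
exists (fun i => oapp l k (unlift ord0 i)).
rewrite big_ord_recl unlift_none /=.
by under eq_bigr do rewrite liftK /=; rewrite -E addrC subrK.
Qed.

End Span.

Section Final.
Variables (R : realType) (a b c : R) (n : nat).
Hypothesis c0 : c != 0.

Lemma generatorP_b Y : b != 0 -> lie_generator (F1 a b c n.+1) (F2 a b c n.+1) Y <->
  exists k t0 x0 al, [/\ Y = affine_field k t0 x0 al 0 0 al,
     k = - (n.+1%:R * al) & a * al = 0].
Proof.
move=> b0; split.
  move=> /(generator_affine c0)[].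
    by move=> k chi al be ga ep de ze H1 H2; have [_ []] := flux_eqs_b b0 H1 H2.
  move=> k [t0 [x0 [al [be [ep [de [-> H1 H2]]]]]]].
  have [[be0 ep0 deE kE] [aal _ _ _]] := flux_eqs_b b0 H1 H2.
  by exists k, t0, x0, al; subst be ep de; split.
move=> [k [t0 [x0 [al [-> kE aal]]]]].
have H : sols_b a n al 0 0 0 al 0 k 0 by [].
by apply: affine_field_generator; apply: sols_b_flux_eqs.
Qed.

Lemma generatorP_a Y : b = 0 -> a != 0 ->
  lie_generator (F1 a b c n.+1) (F2 a b c n.+1) Y <->
  exists k t0 x0 al be ep de, Y = affine_field k t0 x0 al be ep de /\
     sols_a n al be 0 ep de 0 k 0.
Proof.
move=> b0 a0; split.
  move=> /(generator_affine c0)[].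
    by move=> k chi al be ga ep de ze H1 H2; have [] := flux_eqs_a b0 a0 H1 H2.
  move=> k [t0 [x0 [al [be [ep [de [-> H1 H2]]]]]]].
  by exists k, t0, x0, al, be, ep, de; split=> //; apply: flux_eqs_a H1 H2.
move=> [k [t0 [x0 [al [be [ep [de [-> H]]]]]]]].
by apply: affine_field_generator; apply: sols_a_flux_eqs => //; apply: sols_aC.
Qed.

End Final.

Ltac vfield_eq := apply/funext; case; apply/funext => q;
  rewrite /= ?(vfieldD, vfieldZ) /=.

Theorem proposition1 (R : realType) (a b c : R) (p : nat)
    (hc : c != 0) (hab : (a, b) != (0, 0)) (hp : (1 <= p)%N) :
  [/\ a = 0 ->
        [set X : vfield R | lie_generator (F1 a b c p) (F2 a b c p) X]
        = vspan [:: X1 R p; X2 R; X3 R],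
      b = 0 ->
        [set X : vfield R | lie_generator (F1 a b c p) (F2 a b c p) X]
        = vspan ([:: Y1 R p; X2 R; X3 R]
                 ++ (if p == 1%N then [:: X4 R; X5 R] else [::])
                 ++ (if p == 2%N then [:: Y4 R] else [::]))
    & a * b != 0 ->
        [set X : vfield R | lie_generator (F1 a b c p) (F2 a b c p) X]
        = vspan [:: X2 R; X3 R]].
Proof.
case: p hp => // n _.
have p0 : n.+1%:R != 0 :> R by rewrite pnatr_eq0.
split.
- move=> a0; have b0 : b != 0.
    by apply: contra hab => /eqP ->; rewrite a0.
  apply/seteqP; split=> Y /=.
    move=> /(generatorP_b _ _ hc _ b0)[k [t0 [x0 [al [-> kE _]]]]].
    apply/vspan_cons; exists k; apply/vspan_cons; exists t0.
    apply/vspan_cons; exists x0; apply/vspan_nil.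
    apply/eqP; rewrite !subr_eq add0r; apply/eqP.
    have -> : al = - (1 / n.+1%:R) * k by rewrite kE; field.
    by vfield_eq; ring.
  move=> /vspan_cons[k /vspan_cons[t0 /vspan_cons[x0 /vspan_nil/eqP]]].
  rewrite !subr_eq add0r => /eqP ->.
  apply/generatorP_b => //; exists k, t0, x0, (- (1 / n.+1%:R) * k).
  split; [by vfield_eq; ring|by field|by rewrite a0 mul0r].
- move=> b0; have a0 : a != 0.
    by apply: contra hab => /eqP ->; rewrite b0.
  apply/seteqP; split=> Y /=.
    move=> /(generatorP_a _ hc _ b0 a0)[k [t0 [x0 [al [be [ep [de [-> [_ H]]]]]]]]].
    apply/vspan_cons; exists k; apply/vspan_cons; exists t0.
    apply/vspan_cons; exists x0.
    case: n p0 H => [|[|m]] p0 /=.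
    + move=> [E1 E2].
      apply/vspan_cons; exists be; apply/vspan_cons; exists (- ep); apply/vspan_nil.
      apply/eqP; rewrite !subr_eq add0r; apply/eqP.
      have -> : al = - 2 * k - ep by lra.
      have -> : de = - 2 * k - be by lra.
      by vfield_eq; field.
    + move=> [E1 E2 E3].
      apply/vspan_cons; exists be; apply/vspan_nil.
      apply/eqP; rewrite !subr_eq add0r; apply/eqP.
      have -> : al = - k by lra.
      have -> : de = - k by lra.
      have -> : ep = - be by lra.
      by vfield_eq; field.
    + move=> [-> -> -> E].
      apply/vspan_nil; apply/eqP; rewrite !subr_eq add0r; apply/eqP.
      have -> : al = - (2 / m.+3%:R) * k.
        apply: (mulfI p0); rewrite mulrA mulrN mulrCA mulfV // mulr1.
        by apply/eqP; rewrite -subr_eq0 mulNr opprK addrC; apply/eqP.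
      by vfield_eq; ring.
  move=> /vspan_cons[k /vspan_cons[t0 /vspan_cons[x0]]] H.
  apply/generatorP_a => //; exists k, t0, x0.
  case: n p0 H => [|[|m]] p0 /=.
  + move=> /vspan_cons[be /vspan_cons[ep /vspan_nil/eqP]].
    rewrite !subr_eq add0r => /eqP ->.
    exists (- 2 * k + ep), be, (- ep), (- 2 * k - be).
    split; first by vfield_eq; field.
    by split=> //; split; ring.
  + move=> /vspan_cons[be /vspan_nil/eqP]; rewrite !subr_eq add0r => /eqP ->.
    exists (- k), be, (- be), (- k).
    split; first by vfield_eq; field.
    by split=> //; split; ring.
  + move=> /vspan_nil/eqP; rewrite !subr_eq add0r => /eqP ->.
    exists (- (2 / m.+3%:R) * k), 0, 0, (- (2 / m.+3%:R) * k).
    split; first by vfield_eq; ring.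
    by split=> //; split=> //; field.
- rewrite mulf_eq0 negb_or => /andP[a0 b0].
  apply/seteqP; split=> Y /=.
    move=> /(generatorP_b _ _ hc _ b0)[k [t0 [x0 [al [-> kE /eqP]]]]].
    rewrite mulf_eq0 (negbTE a0) /= => /eqP al0; move: kE; rewrite al0 mulr0 oppr0 => ->.
    apply/vspan_cons; exists t0; apply/vspan_cons; exists x0; apply/vspan_nil.
    by apply/eqP; rewrite !subr_eq add0r; apply/eqP; vfield_eq; ring.
  move=> /vspan_cons[t0 /vspan_cons[x0 /vspan_nil/eqP]].
  rewrite !subr_eq add0r => /eqP ->.
  apply/generatorP_b => //; exists 0, t0, x0, 0.
  by split; [vfield_eq; ring|rewrite mulr0 oppr0|rewrite mulr0].
Qed.
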